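(* Let $m,n\ge 1$ be integers and let $\varphi:\mathbb{R}^m\to\mathbb{R}^n$ be a continuous map. The following conditions are equivalent: (i) for every function $f\in PW(\mathbb{R}^n)$ the superposition $f\circ\varphi$ belongs to $PW(\mathbb{R}^m)$; (ii) $\varphi$ is an injective affine map.
   Context: For an integer $d\ge 1$, $PW(\mathbb{R}^d)$ denotes the class of all functions $f:\mathbb{R}^d\to\mathbb{C}$ of the form $$f(t)=\int_B g(u)e^{i(u,t)}\,du,\qquad t\in\mathbb{R}^d,$$ where $g$ is an arbitrary (complex-valued) function in $L^2(\mathbb{R}^d)$, $B\subset\mathbb{R}^d$ is an arbitrary ball (of finite radius; both $g$ and $B$ may depend on $f$), and $(u,t)$ is the standard inner product on $\mathbb{R}^d$. The equality holds for every $t$. Equivalently, $PW(\mathbb{R}^d)$ consists of the continuous functions in $L^2(\mathbb{R}^d)$ whose Fourier transform vanishes outside some ball. A map $\varphi:\mathbb{R}^m\to\mathbb{R}^n$ is affine if $\varphi(t)=At+b$ for some real $n\times m$ matrix $A$ and some $b\in\mathbb{R}^n$. *)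

(* Defs.v *)
From HB Require Import structures.
From mathcomp Require Import all_boot all_order all_algebra.
From mathcomp Require Import complex.
From mathcomp Require Import all_classical all_reals all_analysis.

Set Implicit Arguments.
Unset Strict Implicit.
Unset Printing Implicit Defensive.
Import Order.TTheory GRing.Theory Num.Theory.
Import numFieldNormedType.Exports.

Local Open Scope classical_set_scope.
Local Open Scope ring_scope.

Definition cV_display : measure_display.
Proof. exact. Qed.

(* R^n is 'cV[R]_n, with the sigma-algebra generated by the coordinates;
   it coincides with the Borel sigma-algebra. *)
Section measurable_cV.
Context {R : realType} (n : nat).

Let coord (i : 'I_n) (x : 'cV[R]_n) : R := x i ord0.

Let cV_set0 : g_sigma_preimage coord set0.
Proof. exact: sigma_algebra0. Qed.

Let cV_setC A : g_sigma_preimage coord A -> g_sigma_preimage coord (~` A).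
Proof. exact: sigma_algebraC. Qed.

Let cV_bigcup (F : (set 'cV[R]_n)^nat) :
  (forall i, g_sigma_preimage coord (F i)) ->
  g_sigma_preimage coord (\bigcup_i F i).
Proof. exact: sigma_algebra_bigcup. Qed.

HB.instance Definition _ := @isMeasurable.Build cV_display
  'cV[R]_n (g_sigma_preimage coord) cV_set0 cV_setC cV_bigcup.

End measurable_cV.

Lemma measurable_coord_cV (R : realType) n (i : 'I_n) :
  measurable_fun [set: 'cV[R]_n] (fun x : 'cV[R]_n => x i ord0).
Proof.
move=> _ Y mY; rewrite setTI; apply: sub_sigma_algebra => /=.
rewrite -bigcup_seq/=; exists i => /=; first by rewrite mem_index_enum.
by exists Y => //; rewrite setTI.
Qed.

Lemma measurable_fun_cVP d (T : measurableType d) (R : realType) n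
    (f : T -> 'cV[R]_n) :
  (forall i, measurable_fun [set: T] (fun t => f t i ord0)) ->
  measurable_fun [set: T] f.
Proof.
move=> mf _ A mA; rewrite setTI.
suff: <<s \big[setU/set0]_(i < n)
   preimage_set_system setT (fun x : 'cV[R]_n => x i ord0) measurable >>
   `<=` [set B | measurable (f @^-1` B)] by apply.
apply: smallest_sub.
  split => [|B mB|F mF] /=.
  - by rewrite preimage_set0.
  - by rewrite setTD -preimage_setC; exact: measurableC.
  - by rewrite preimage_bigcup; exact: bigcupT_measurable.
rewrite -bigcup_seq/= => B [i _ [C mC <-]] /=; rewrite setTI.
by have := mf i measurableT C mC; rewrite setTI.
Qed.

Section lebesgue_cV.
Context {R : realType}.

Definition cons_cV n (p : measurableTypeR R * 'cV[R]_n) : 'cV[R]_n.+1 :=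
  col_mx (const_mx (p.1 : R) : 'cV[R]_1) p.2.

Lemma cons_cV0 n (p : measurableTypeR R * 'cV[R]_n) :
  cons_cV p ord0 ord0 = p.1.
Proof.
have -> : ord0 = lshift n ord0 :> 'I_(1 + n) by exact/val_inj.
by rewrite /cons_cV (@col_mxEu _ 1) mxE.
Qed.

Lemma cons_cVS n (p : measurableTypeR R * 'cV[R]_n) (i : 'I_n) :
  cons_cV p (lift ord0 i) ord0 = p.2 i ord0.
Proof.
have -> : lift ord0 i = rshift 1 i :> 'I_(1 + n) by exact/val_inj.
by rewrite /cons_cV (@col_mxEd _ 1).
Qed.

Lemma measurable_cons_cV n : measurable_fun setT (@cons_cV n).
Proof.
apply: measurable_fun_cVP => i; case: (unliftP ord0 i) => [j|] ->.
  under eq_fun do rewrite cons_cVS.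
  apply: (@measurableT_comp _ _ _ _ _ _ (fun x : 'cV[R]_n => x j ord0)) => //.
  exact: measurable_coord_cV.
by under eq_fun do rewrite cons_cV0; exact: measurable_fst.
Qed.

Section lebesgue_step.
Variables (n : nat) (mu : {sigma_finite_measure set 'cV[R]_n -> \bar R}).

Definition lebesgue_step : set 'cV[R]_n.+1 -> \bar R :=
  pushforward (@lebesgue_measure R \x mu)%E (@cons_cV n).

Let preimageT A : measurable A -> measurable (@cons_cV n @^-1` A).
Proof. by move=> mA; rewrite -[X in measurable X]setTI; exact: measurable_cons_cV. Qed.

Let lebesgue_step0 : lebesgue_step set0 = 0%E.
Proof. by rewrite /lebesgue_step /pushforward preimage_set0 measure0. Qed.

Let lebesgue_step_ge0 A : (0 <= lebesgue_step A)%E.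
Proof. exact: (measure_ge0 (@lebesgue_measure R \x mu)%E). Qed.

Let lebesgue_step_sigma_additive : semi_sigma_additive lebesgue_step.
Proof.
move=> F mF tF mUF; rewrite /lebesgue_step /pushforward preimage_bigcup.
apply: measure_semi_sigma_additive => [k||].
- exact: preimageT.
- apply/trivIsetP => i j _ _ ij; rewrite -preimage_setI.
  by move/trivIsetP : tF => /(_ _ _ _ _ ij) ->//; rewrite preimage_set0.
- by rewrite -preimage_bigcup; exact: preimageT.
Qed.

HB.instance Definition _ := isMeasure.Build _ _ _ lebesgue_step
  lebesgue_step0 lebesgue_step_ge0 lebesgue_step_sigma_additive.

Let lebesgue_step_sigma_finite : sigma_finite setT lebesgue_step.
Proof.
have /sigma_finiteP[F [TF ndF Foo]] := sigma_finiteT (@lebesgue_measure R).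
have /sigma_finiteP[G [TG ndG Goo]] := sigma_finiteT mu.
pose h (x : 'cV[R]_n.+1) : measurableTypeR R * 'cV[R]_n :=
  (x ord0 ord0, \col_i x (lift ord0 i) ord0).
have mh : measurable_fun setT h.
  apply: measurable_fun_pair; first exact: measurable_coord_cV.
  apply: measurable_fun_cVP => i.
  rewrite (_ : (fun _ => _) = (fun x : 'cV[R]_n.+1 => x (lift ord0 i) ord0)).
    exact: measurable_coord_cV.
  by apply/funext => x; rewrite mxE.
have hK p : h (cons_cV p) = p.
  case: p => a u; rewrite /h cons_cV0; congr pair.
  by apply/colP => i; rewrite mxE cons_cVS.
exists (fun k => h @^-1` (F k `*` G k)).
  apply/esym/seteqP; split => [x _ //|x _]; rewrite -preimage_bigcup /=.
  have [k _ Fk] : (\bigcup_k F k) (h x).1 by rewrite -TF.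
  have [l _ Gl] : (\bigcup_k G k) (h x).2 by rewrite -TG.
  exists (maxn k l) => //; split.
  - by move: Fk; exact/subsetPset/ndF/leq_maxl.
  - by move: Gl; exact/subsetPset/ndG/leq_maxr.
move=> k; have [mFk Fkoo] := Foo k; have [mGk Gkoo] := Goo k; split.
  by rewrite -[X in measurable X]setTI; apply: mh => //; exact: measurableX.
rewrite /lebesgue_step /pushforward -comp_preimage.
rewrite (_ : h \o _ = id) ?preimage_id; last exact/funext.
by rewrite product_measure1E// lte_mul_pinfty// ge0_fin_numE.
Qed.

HB.instance Definition _ := Measure_isSigmaFinite.Build _ _ _ lebesgue_step
  lebesgue_step_sigma_finite.

End lebesgue_step.

(* Lebesgue measure on R^n is the n-fold product of Lebesgue measure on R, R^0
   carrying the unit mass. *)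
Fixpoint lebesgue_cV n : {sigma_finite_measure set 'cV[R]_n -> \bar R} :=
  if n is n'.+1 then lebesgue_step (lebesgue_cV n') else \d_(0 : 'cV[R]_0).

Lemma lebesgue_cV_box n (A : 'I_n -> set R) :
  (forall i, measurable (A i)) ->
  lebesgue_cV n [set x | forall i, A i (x i ord0)] =
  (\prod_(i < n) lebesgue_measure (A i))%E.
Proof.
elim: n A => [|n IH] A mA.
  by rewrite /= diracE big_ord0 mem_set// => -[].
rewrite big_ord_recl /= /lebesgue_step /pushforward.
pose B := [set x : 'cV[R]_n | forall i, A (lift ord0 i) (x i ord0)].
rewrite (_ : _ @^-1` _ = A ord0 `*` B).
  have mB : measurable B.
    rewrite (_ : B = \bigcap_(i in [set: 'I_n])
        ((fun x : 'cV[R]_n => x i ord0) @^-1` A (lift ord0 i))).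
      apply: fin_bigcap_measurable => // i _.
      by rewrite -[X in measurable X]setTI; exact: measurable_coord_cV.
    by apply/seteqP; split => x /= Bx i => [_|]; exact: Bx.
  rewrite product_measure1E//; last exact: mA.
  by congr (_ * _)%E; exact: (IH (fun i => A (lift ord0 i))).
apply/seteqP; split => [p /= Ap|p /= [Ap Bp] i].
  by split => [|i]; [rewrite -cons_cV0|rewrite -cons_cVS].
by case: (unliftP ord0 i) => [j ->|->]; rewrite ?cons_cV0 ?cons_cVS.
Qed.

End lebesgue_cV.

Section paley_wiener.
Context {R : realType}.
Local Open Scope complex_scope.

Definition dotv d (u v : 'cV[R]_d) : R := \sum_i u i ord0 * v i ord0.

(* Euclidean balls: the library's [ball] on matrices is the sup-norm one *)
Definition eball d (c : 'cV[R]_d) (r : R) : set 'cV[R]_d :=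
  [set u | dotv (u - c) (u - c) < r ^+ 2].

Definition expi (x : R) : R[i] := cos x +i* sin x.

Definition cintegral d (D : set 'cV[R]_d) (h : 'cV[R]_d -> R[i]) : R[i] :=
  (\int[lebesgue_cV d]_(u in D) complex.Re (h u))
    +i* (\int[lebesgue_cV d]_(u in D) complex.Im (h u)).

(* Functions rather than classes modulo a.e. equality; every class has such a
   Borel representative. *)
Definition L2 d (g : 'cV[R]_d -> R[i]) : Prop :=
  [/\ measurable_fun setT (fun u => complex.Re (g u)),
      measurable_fun setT (fun u => complex.Im (g u)) &
      (\int[lebesgue_cV d]_u ((ComplexField.Normc.normc (g u)) ^+ 2)%:E < +oo)%E].

(* The integrand is integrable, since the ball has finite measure; hence
   [cintegral] does not hit the default values of [fine] here. *)
Definition PW d (f : 'cV[R]_d -> R[i]) : Prop :=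
  exists (g : 'cV[R]_d -> R[i]) (c : 'cV[R]_d) (r : R),
    [/\ L2 g, 0 < r &
      forall t, f t = cintegral (eball c r) (fun u => g u * expi (dotv u t))].

Definition affine_map m n (phi : 'cV[R]_m -> 'cV[R]_n) : Prop :=
  exists (A : 'M[R]_(n, m)) (b : 'cV[R]_n), forall t, phi t = A *m t + b.

End paley_wiener.

(* Main.v *)
Require Import Defs.
From HB Require Import structures.
From mathcomp Require Import all_boot all_order all_algebra.
From mathcomp Require Import complex.
From mathcomp Require Import all_classical all_reals all_analysis.
From mathcomp Require Import measurable_realfun.
From mathcomp Require Import ring lra.

(* Sufficiency.  The density of [f (A t + b)] is that of the push-forward of
   [g(u) e^{i(u,b)} du] by [A^T]; completing [A^T] to an invertible matrix and using
   that Lebesgue measure is, up to a factor, the only translation-invariant measure,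
   it is an integral of [g] over fibres, in L^2 by Cauchy-Schwarz.

   Necessity.  Call a function of a real variable band-limited of type (M, N) if its
   k-th differences with step h are at most M (N |h|)^k.  Restrictions of
   Paley-Wiener functions to lines have this property, which is stable under
   products and pointwise limits; and by Newton's forward formula, a function of
   type (M, N) that is O(s^p) at 0 is at most M e^{N|x|} (N|x|)^p / p! everywhere.
   Fix a line [t + s v], a coordinate [psi] of [phi] along it, and [f] in PW that does
   not vanish at the relevant points.  All [e^{i r psi} f(phi)] are band-limited, and
   by Baire's theorem uniformly so for [r] in some interval [a, b].  With
   D(s) = psi(s) + psi(-s) - 2 psi(0), the products of these functions at [s] and [-s]
   combine into e^{iaD} (e^{i(b-a)D/j} - 1)^j f(phi(s)) f(phi(-s)), which is
   O(s^{2j}) and of type (2^j N^2, 2N); its value at [s = 1] is therefore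
   O(C^j / (2j)!), and letting [j] grow gives D(1) = 0.  So [phi] preserves midpoints and
   is affine.  If [A v = 0] with [v <> 0], composing with [s |-> s v] would put a nonzero
   constant in PW(R), which is impossible. *)

Set Implicit Arguments.
Unset Strict Implicit.
Unset Printing Implicit Defensive.
Import Order.TTheory GRing.Theory Num.Theory.
Import numFieldNormedType.Exports.

Local Open Scope classical_set_scope.
Local Open Scope ring_scope.
Local Open Scope complex_scope.

Local Notation nc := (@ComplexField.Normc.normc _).

(** * The modulus of a complex number as a real number *)

Section complex_modulus.
Context {R : realType}.
Implicit Types (z w : R[i]) (x y : R).

Lemma ncM z w : nc (z * w) = nc z * nc w.
Proof. exact: ComplexField.Normc.normcM. Qed.

Lemma nc_ge0 z : 0 <= nc z.
Proof. by case: z => a b /=; exact: sqrtr_ge0. Qed.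

Lemma nc0 : nc (0 : R[i]) = 0. Proof. exact: ComplexField.Normc.normc0. Qed.

Lemma nc1 : nc (1 : R[i]) = 1. Proof. exact: ComplexField.Normc.normc1. Qed.

Lemma ncD z w : nc (z + w) <= nc z + nc w.
Proof. exact: le_normcD. Qed.

Lemma ncN z : nc (- z) = nc z.
Proof. exact: normcN. Qed.

Lemma ncMn z n : nc (z *+ n) = nc z *+ n.
Proof. exact: normcMn. Qed.

Lemma ncX z n : nc (z ^+ n) = nc z ^+ n.
Proof. by elim: n => [|n IH]; rewrite ?expr0 ?nc1// !exprS ncM IH. Qed.

Lemma nc_eq0 z : (nc z == 0) = (z == 0).
Proof.
apply/eqP/eqP => [|->]; [exact: ComplexField.Normc.eq0_normc|exact: nc0].
Qed.

Lemma nc_gt0 z : (0 < nc z) = (z != 0).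
Proof. by rewrite lt_def nc_ge0 andbT nc_eq0. Qed.

Lemma nc_sum (I : Type) (r : seq I) (P : pred I) (F : I -> R[i]) :
  nc (\sum_(i <- r | P i) F i) <= \sum_(i <- r | P i) nc (F i).
Proof.
elim/big_rec2: _ => [|i y z _ IH]; first by rewrite nc0.
by rewrite (le_trans (ncD _ _))// lerD2l.
Qed.

Lemma sqr_nc z : nc z ^+ 2 = complex.Re z ^+ 2 + complex.Im z ^+ 2.
Proof. by case: z => a b /=; rewrite sqr_sqrtr// addr_ge0// sqr_ge0. Qed.

Lemma normr_Re_le z : `|complex.Re z| <= nc z.
Proof.
by rewrite -(ler_pXn2r (n := 2))// ?nnegrE ?nc_ge0// sqr_nc real_normK ?num_real//
  lerDl sqr_ge0.
Qed.

Lemma normr_Im_le z : `|complex.Im z| <= nc z.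
Proof.
by rewrite -(ler_pXn2r (n := 2))// ?nnegrE ?nc_ge0// sqr_nc real_normK ?num_real//
  lerDr sqr_ge0.
Qed.

Lemma nc_le_ReIm z : nc z <= `|complex.Re z| + `|complex.Im z|.
Proof.
rewrite -(ler_pXn2r (n := 2))// ?nnegrE ?nc_ge0 ?addr_ge0//.
rewrite sqr_nc sqrrD !real_normK ?num_real// addrAC lerDl.
by rewrite mulrn_wge0// mulr_ge0.
Qed.

End complex_modulus.

(** * Chords of the unit circle *)

Section expi.
Context {R : realType}.
Implicit Types x y : R.

Lemma expi0 : expi (0 : R) = 1.
Proof. by rewrite /expi cos0 sin0. Qed.

Lemma expiD x y : expi (x + y) = expi x * expi y.
Proof.
rewrite /expi cosD sinD; apply/eqP; rewrite eq_complex /=; apply/andP; split=> //.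
by rewrite addrC.
Qed.

Lemma expiMn x n : expi (x *+ n) = expi x ^+ n.
Proof.
by elim: n => [|n IH]; rewrite ?mulr0n ?expi0// mulrS expiD IH exprS.
Qed.

Lemma nc_expi x : nc (expi x) = 1.
Proof. by rewrite /= cos2Dsin2 sqrtr1. Qed.

Lemma sin_MVT x : 0 <= x -> exists2 c, 0 <= c <= x & sin x = cos c * x.
Proof.
move=> x0.
have [|c] := @MVT_segment R sin cos 0 x x0.
  by apply: continuous_subspaceT => z; exact: continuous_sin.
by rewrite sin0 !subr0 in_itv/= => c0 ->; exists c.
Qed.

Lemma sin_le_abs x : `|sin x| <= `|x|.
Proof.
wlog x0 : x / 0 <= x => [hw|].
  have [|/ltW x0] := leP 0 x; first exact: hw.
  by rewrite -normrN -sinN -[leRHS]normrN; apply: hw; rewrite oppr_ge0.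
have [c _ ->] := sin_MVT x0.
by rewrite normrM ler_piMl// cos_max.
Qed.

Lemma cosE_sin_half x : cos x = 1 - 2 * sin (x / 2) ^+ 2.
Proof.
have {1}-> : x = (x / 2) *+ 2 by rewrite -mulr_natr divfK.
by rewrite cos_mulr2n; have := cos2Dsin2 (x / 2); lra.
Qed.

Lemma cos_ge_quadratic x : 1 - x ^+ 2 / 2 <= cos x.
Proof.
rewrite cosE_sin_half; have := sin_le_abs (x / 2).
rewrite -(ler_pXn2r (n := 2))// ?nnegrE// !real_normK ?num_real//.
rewrite exprMn; lra.
Qed.

(** The mean value theorem gives [sin x = cos c * x] with [c] in [0, 1], where the quadratic lower
    bound makes [cos c] at least 1/2. *)
Lemma sin_ge_half x : `|x| <= 1 -> `|x| / 2 <= `|sin x|.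
Proof.
wlog x0 : x / 0 <= x => [hw x1|].
  have [|/ltW x0] := leP 0 x; first by move/hw; apply.
  rewrite -normrN -[leRHS]normrN -sinN; apply: hw; rewrite ?normrN//.
  by rewrite oppr_ge0.
rewrite ger0_norm// => x1; have [c /andP[c0 cx] ->] := sin_MVT x0.
rewrite normrM (ger0_norm x0) mulrC ler_wpM2r//.
have := cos_ge_quadratic c; have : c ^+ 2 <= 1 by rewrite expr_le1//; lra.
by move=> ? ?; rewrite ger0_norm; lra.
Qed.

(** Both squares equal [2 - 2 * cos x]. This turns the bounds on the sine into a two-sided
    comparison of [expi x - 1] with [x] near 0. *)
Lemma nc_expi_sub1 x : nc (expi x - 1) = 2 * `|sin (x / 2)|.
Proof.
apply/eqP; rewrite -(eqrXn2 (n := 2))// ?nc_ge0 ?mulr_ge0//; apply/eqP.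
rewrite sqr_nc /= exprMn real_normK ?num_real// subr0.
have := cos2Dsin2 x; rewrite cosE_sin_half.
by move=> h; rewrite -(addrK (sin x ^+ 2) (_ ^+ 2 + _)); lra.
Qed.

Lemma nc_expi_sub1_le x : nc (expi x - 1) <= `|x|.
Proof.
rewrite nc_expi_sub1; have := sin_le_abs (x / 2).
by rewrite normrM normfV (ger0_norm (x := 2))//; lra.
Qed.

Lemma nc_expi_sub1_ge x : `|x| <= 1 -> `|x| / 2 <= nc (expi x - 1).
Proof.
move=> x1; rewrite nc_expi_sub1; have := @sin_ge_half (x / 2).
rewrite normrM normfV (ger0_norm (x := 2))//; lra.
Qed.

End expi.

(** * Band-limited functions of a real variable *)

Section bandlim.
Context {R : realType}.
Implicit Types (F G : R -> R[i]) (h s x M N : R).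

Definition dif h F : R -> R[i] := fun s => F (s + h) - F s.

(* Bernstein-type control of all finite differences; unlike derivative bounds
   this is closed under pointwise limits and makes sense without smoothness. *)
Definition bandlim M N F := forall k h s,
  nc (iter k (dif h) F s) <= M * (N * `|h|) ^+ k.

Lemma iter_difD h k F G s :
  iter k (dif h) (fun u => F u + G u) s = iter k (dif h) F s + iter k (dif h) G s.
Proof.
elim: k s => [//|k IH] s /=; rewrite /dif !IH.
by rewrite opprD addrACA.
Qed.

Lemma iter_difZ h k c F s :
  iter k (dif h) (fun u => c * F u) s = c * iter k (dif h) F s.
Proof. by elim: k s => [//|k IH] s /=; rewrite /dif !IH mulrBr. Qed.


Lemma iter_dif_shift h k a F s :
  iter k (dif h) (fun u => F (u + a)) s = iter k (dif h) F (s + a).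
Proof. by elim: k s => [//|k IH] s /=; rewrite /dif !IH addrAC. Qed.

Lemma iter_dif_opp h k F s :
  iter k (dif h) (fun u => F (- u)) s = iter k (dif (- h)) F (- s).
Proof. by elim: k s => [//|k IH] s /=; rewrite /dif !IH opprD. Qed.

Lemma bandlim_opp M N F : bandlim M N F -> bandlim M N (fun s => F (- s)).
Proof. by move=> FQ k h s; rewrite iter_dif_opp -(normrN h). Qed.

Lemma bandlim_ge0 M N F : bandlim M N F -> 0 <= M.
Proof.
by move=> /(_ 0%N 0 0) /=; rewrite expr0 mulr1; exact/le_trans/nc_ge0.
Qed.

Lemma bandlim_le M N K L F : 0 <= N -> M <= K -> N <= L ->
  bandlim M N F -> bandlim K L F.
Proof.
move=> N0 MK NL FQ k h s; rewrite (le_trans (FQ k h s))//.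
have M0 := bandlim_ge0 FQ.
rewrite ler_pM// ?exprn_ge0 ?mulr_ge0//.
by rewrite lerXn2r// ?nnegrE ?mulr_ge0// ?(le_trans N0 NL)// ler_wpM2r.
Qed.

Lemma bandlimZ M N c F : bandlim M N F -> bandlim (nc c * M) N (fun s => c * F s).
Proof.
by move=> FQ k h s; rewrite iter_difZ ncM -mulrA ler_wpM2l// nc_ge0.
Qed.

Lemma bandlimD M K N F G : bandlim M N F -> bandlim K N G ->
  bandlim (M + K) N (fun s => F s + G s).
Proof.
move=> FQ GQ k h s; rewrite iter_difD mulrDl.
by rewrite (le_trans (ncD _ _))// lerD.
Qed.

Lemma bandlim_sum (n : nat) (M : 'I_n -> R) N (H : 'I_n -> R -> R[i]) :
  (forall i, bandlim (M i) N (H i)) ->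
  bandlim (\sum_i M i) N (fun s => \sum_i H i s).
Proof.
elim: n M H => [|n IH] M H HQ.
  (* Written as a multiple by 0, the empty sum has vanishing differences by [iter_difZ]. *)
  rewrite big_ord0 (_ : (fun s => _) = (fun s => 0 * (0 : R[i]))).
    move=> k h s; rewrite (iter_difZ h k 0 (fun=> 0)) mul0r nc0 mul0r//.
  by apply/funext => s; rewrite big_ord0 mul0r.
rewrite big_ord_recl.
rewrite (_ : (fun s => _) =
  (fun s => H ord0 s + \sum_(i < n) H (lift ord0 i) s)).
  apply: bandlimD => //.
  by apply: (IH (fun i => M (lift ord0 i)) (fun i => H (lift ord0 i))) => i.
by apply/funext => s; rewrite big_ord_recl.
Qed.

(** Discrete Leibniz rule: a difference of the product falls either on [F], at the cost of a factor
    [N * |h|], or on [G], at the cost of [L * |h|]. Over [k] differences these costs add up to the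
    [k]-th power of the sum. *)
Lemma bandlimM M K N L F G : 0 <= N -> 0 <= L ->
  bandlim M N F -> bandlim K L G -> bandlim (M * K) (N + L) (fun s => F s * G s).
Proof.
move=> N0 L0 FQ GQ k h.
have {}FQ : forall k s, nc (iter k (dif h) F s) <= M * (N * `|h|) ^+ k by [].
have {}GQ : forall k s, nc (iter k (dif h) G s) <= K * (L * `|h|) ^+ k by [].
rewrite mulrDl; move: FQ GQ.
have : 0 <= N * `|h| by rewrite mulr_ge0.
have : 0 <= L * `|h| by rewrite mulr_ge0.
(* With [h] fixed, only the two costs per difference matter; the induction then lets [F], [G], [M]
   and [K] vary. *)
move: (N * _) (L * _) => {L0 N0} {}L {}N N0 L0.
elim: k F G M K => [|k IH] F G M K FQ GQ s.
  rewrite expr0 mulr1 /= ncM ler_pM ?nc_ge0//.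
    by have := FQ 0%N s; rewrite expr0 mulr1.
  by have := GQ 0%N s; rewrite expr0 mulr1.
rewrite iterSr.
rewrite (_ : dif h _ = fun u => dif h F u * G (u + h) + F u * dif h G u); last first.
  by apply/funext => u; rewrite /dif; ring.
rewrite iter_difD (le_trans (ncD _ _))//.
have -> : M * K * (L + N) ^+ k.+1 =
  (M * L) * K * (L + N) ^+ k + M * (K * N) * (L + N) ^+ k by rewrite exprS; ring.
apply: lerD.
  apply: (IH (dif h F) (fun u => G (u + h))) => [j u|j u].
    by rewrite -iterSr -mulrA -exprS.
  by rewrite iter_dif_shift.
apply: (IH F (dif h G)) => [//|j u].
by rewrite -iterSr -mulrA -exprS.
Qed.

(** The binomial theorem for the shift, which is the identity plus [dif h]; the induction uses
    Pascal's rule. *)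
Lemma newton_forward F s h n :
  F (s + n%:R * h) = \sum_(k < n.+1) (iter k (dif h) F s) *+ 'C(n, k).
Proof.
elim: n F => [|n IH] F; first by rewrite mul0r addr0 big_ord1.
rewrite -natr1 mulrDl mul1r addrA (IH (fun u => F (u + h))).
have E k : iter k (dif h) (fun u => F (u + h)) s =
    iter k (dif h) F s + iter k.+1 (dif h) F s.
  by rewrite iter_dif_shift /= [in RHS]/dif [RHS]addrC subrK.
under eq_bigr do rewrite E mulrnDl.
rewrite big_split /= [RHS]big_ord_recl bin0.
under [in RHS]eq_bigr do rewrite lift0 binS mulrnDr.
rewrite big_split /= addrA; congr (_ + _).
by rewrite big_ord_recl bin0 [in RHS]big_ord_recr /= (bin_small (ltnSn n)) mulr0n addr0.
Qed.

Lemma nc_iter_dif_le h k F s c :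
  (forall i, (i <= k)%N -> nc (F (s + i%:R * h)) <= c) ->
  nc (iter k (dif h) F s) <= 2 ^+ k * c.
Proof.
elim: k s => [|k IH] s Fc.
  by have := Fc 0%N isT; rewrite mul0r addr0 expr0 mul1r.
rewrite /= {1}/dif (le_trans (ncD _ _))// ncN exprS.
have -> : 2 * 2 ^+ k * c = 2 ^+ k * c + 2 ^+ k * c by ring.
apply: lerD; apply: IH => i ik.
  by have := Fc i.+1 ik; rewrite -natr1 mulrDl mul1r addrA addrAC.
by apply: Fc; rewrite (leq_trans ik)//.
Qed.

End bandlim.

(** * Band-limited functions that are flat at the origin *)

Section flat.
Context {R : realType}.
Implicit Types (F : R -> R[i]) (x y M N C : R).

Lemma sum_exp_coeff_le (y : R) n : 0 <= y -> \sum_(k < n) y ^+ k / k`!%:R <= expR y.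
Proof.
move=> y0; rewrite -(big_mkord xpredT (fun k => y ^+ k / k`!%:R)).
apply: (@nondecreasing_cvgn_le _ (series (exp_coeff y))).
  apply/nondecreasing_series => i _ _; exact: exp_coeff_ge0.
exact: is_cvg_series_exp_coeff.
Qed.

Lemma ffact_le_expn (n k : nat) : (n ^_ k <= n ^ k)%N.
Proof.
elim: k => [|k IH]; first by rewrite ffactn0.
by rewrite ffactnSr expnSr leq_mul// leq_subr.
Qed.

Lemma bin_le_expn_fact (n k : nat) : 'C(n, k)%:R <= n%:R ^+ k / k`!%:R :> R.
Proof.
rewrite ler_pdivlMr ?ltr0n ?fact_gt0// -natrM bin_ffact -natrX ler_nat.
exact: ffact_le_expn.
Qed.

Lemma fact_mul_le (p q : nat) : (p`! * q`! <= (p + q)`!)%N.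
Proof.
rewrite -(@bin_fact (p + q) p) ?leq_addr// addKn leq_pmull//.
by rewrite bin_gt0 leq_addr.
Qed.

(* Newton's forward formula with step [x / n]: as [n] grows, the terms of
   order [k < p] vanish because [F] is flat at [0], and those of order
   [k >= p] are dominated by the tail of the exponential series. *)
Lemma bandlim_flat M N C eta p F x : 0 <= N -> 0 <= C -> 0 < eta ->
  bandlim M N F -> (forall s, `|s| < eta -> nc (F s) <= C * `|s| ^+ p) ->
  nc (F x) <= M * ((N * `|x|) ^+ p / p`!%:R * expR (N * `|x|)).
Proof.
move=> N0 C0 eta0 FQ Fp; set y := N * `|x|.
have M0 := bandlim_ge0 FQ.
have y0 : 0 <= y by rewrite mulr_ge0.
(* [K / n] will bound the sum of the [p] terms of order below [p]: each is at most
   [2 ^+ p * C * (p * |x| / n) ^+ p] times a binomial coefficient, itself at most [n ^+ p / n]. *)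
pose K := p%:R * (2 ^+ p * (C * (p%:R * `|x|) ^+ p)).
have K0 : 0 <= K by rewrite !mulr_ge0// exprn_ge0// mulr_ge0.
apply/ler_addgt0Pl => e e0.
(* Large enough for [K / q <= e], and for the sample points [i * h] with [i < p] to lie within [eta]
   of 0. *)
pose q := (Num.truncn (K / e + p%:R * `|x| / eta)).+1.
have q0 : 0 < q%:R :> R by rewrite ltr0n.
have qbig : K / e + p%:R * `|x| / eta < q%:R by exact: truncnS_gt.
have Kq : K / q%:R <= e.
  rewrite ler_pdivrMr// -ler_pdivrMl// mulrC; apply: le_trans (ltW qbig).
  by rewrite lerDl divr_ge0 ?(ltW eta0)// mulr_ge0.
have etaq : p%:R * `|x| / q%:R < eta.
  rewrite ltr_pdivrMr// -ltr_pdivrMl// mulrC; apply: le_lt_trans qbig.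
  by rewrite lerDr divr_ge0 ?(ltW e0).
pose n := (p + q)%N; pose h := x / n%:R.
have n0 : 0 < n%:R :> R by rewrite ltr0n addn_gt0 orbT.
have qn : q%:R <= n%:R :> R by rewrite ler_nat leq_addl.
have normh : `|h| = `|x| / n%:R by rewrite normrM normfV (gtr0_norm n0).
have -> : F x = F (0 + n%:R * h) by rewrite add0r mulrC divfK// gt_eqF.
rewrite newton_forward; apply: (le_trans (nc_sum _ _ _)).
under eq_bigr do rewrite ncMn -mulr_natr.
have En : n.+1 = (p + q.+1)%N by rewrite addnS.
rewrite En big_split_ord /=.
apply: lerD.
  apply: le_trans Kq.
  apply: (@le_trans _ _ (\sum_(i < p) (2 ^+ p * (C * (p%:R * `|x|) ^+ p)) / q%:R)).
    apply: ler_sum => k _.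
    have kp : (k < p)%N by [].
    have B1 : nc (iter k (dif h) F 0) <=
        2 ^+ p * (C * (p%:R * `|x| / n%:R) ^+ p).
      apply: (@le_trans _ _ (2 ^+ k * (C * (p%:R * `|x| / n%:R) ^+ p))).
        apply: nc_iter_dif_le => i ik; rewrite add0r.
        have ih : `|i%:R * h| <= p%:R * `|x| / n%:R.
          rewrite normrM normh normr_nat mulrA ler_wpM2r ?invr_ge0 ?(ltW n0)//.
          by rewrite ler_wpM2r// ler_nat (leq_trans ik)// ltnW.
        apply: le_trans (Fp _ _) _.
          apply: le_lt_trans ih _; apply: le_lt_trans etaq.
          by rewrite ler_wpM2l ?mulr_ge0// lef_pV2.
        rewrite ler_wpM2l// lerXn2r// nnegrE ?mulr_ge0 ?invr_ge0//.
      rewrite ler_wpM2r ?mulr_ge0 ?exprn_ge0 ?mulr_ge0 ?invr_ge0//.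
      by rewrite ler_weXn2l ?ler1n// ltnW.
    have B2 : 'C(n, k)%:R <= n%:R ^+ p / n%:R :> R.
      have E : n%:R ^+ p / n%:R = n%:R ^+ p.-1 :> R.
        have -> : p = p.-1.+1 by rewrite prednK// (leq_ltn_trans _ kp).
        by rewrite exprSr mulfK// gt_eqF.
      rewrite E; apply: (@le_trans _ _ (n%:R ^+ k / k`!%:R)).
        exact: bin_le_expn_fact.
      apply: (@le_trans _ _ (n%:R ^+ k)).
        rewrite ler_piMr ?exprn_ge0//.
        by rewrite invf_le1 ?ltr0n ?fact_gt0// ler1n fact_gt0.
      by rewrite ler_weXn2l ?ler1n ?addn_gt0 ?orbT// -ltnS prednK// (leq_ltn_trans _ kp).
    apply: (@le_trans _ _ (2 ^+ p * (C * (p%:R * `|x| / n%:R) ^+ p) *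
        (n%:R ^+ p / n%:R))).
      by rewrite ler_pM// nc_ge0.
    rewrite exprMn exprVn.
    set u := (p%:R * `|x|) ^+ p; set v := n%:R ^+ p.
    have v0 : v != 0 by rewrite expf_neq0// gt_eqF.
    have -> : 2 ^+ p * (C * (u / v)) * (v / n%:R) = 2 ^+ p * (C * u) / n%:R.
      by field; rewrite v0 gt_eqF.
    rewrite ler_wpM2l ?mulr_ge0 ?exprn_ge0 ?mulr_ge0//.
    by rewrite lef_pV2.
  by rewrite sumr_const card_ord -[leLHS]mulr_natl [leLHS]mulrA.
(* In the terms of order [p + i] the powers of [n] from the binomial coefficient and from the step
   cancel, and [(p + i)! >= p! * i!] leaves a partial sum of the exponential series. *)
apply: (@le_trans _ _ (\sum_(i < q.+1) M * (y ^+ p / p`!%:R) * (y ^+ i / i`!%:R))).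
  apply: ler_sum => i _.
  apply: (@le_trans _ _ (M * (N * `|h|) ^+ (p + i) * (n%:R ^+ (p + i) / (p + i)`!%:R))).
    by rewrite ler_pM ?nc_ge0// bin_le_expn_fact.
  have -> : N * `|h| = y / n%:R by rewrite normh mulrA.
  rewrite exprMn exprVn.
  set u := y ^+ (p + i); set v := n%:R ^+ (p + i).
  have v0 : v != 0 by rewrite expf_neq0// gt_eqF.
  have -> : M * (u / v) * (v / (p + i)`!%:R) = M * (u / (p + i)`!%:R).
    by field; rewrite v0 pnatr_eq0 -lt0n fact_gt0.
  rewrite -mulrA ler_wpM2l//.
  have -> : y ^+ p / p`!%:R * (y ^+ i / i`!%:R) = u / (p`! * i`!)%:R.
    by rewrite /u exprD natrM invfM; ring.
  rewrite ler_wpM2l ?exprn_ge0// lef_pV2 ?posrE ?ltr0n ?muln_gt0 ?fact_gt0//.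
  by rewrite ler_nat fact_mul_le.
rewrite -mulr_sumr -mulrA ler_wpM2l//.
by rewrite ler_wpM2l ?mulr_ge0 ?exprn_ge0 ?invr_ge0// sum_exp_coeff_le.
Qed.

End flat.

(** * Preservation of midpoints *)

Section midpoint.
Context {R : realType}.

Lemma fact_mul_expn_le (p q : nat) : (p`! * p ^ q <= (p + q)`!)%N.
Proof.
elim: q => [|q IH]; first by rewrite muln1 addn0.
rewrite expnSr mulnA addnS factS mulnC leq_mul//.
by rewrite -addnS leq_addr.
Qed.

(** Since [(j + j)! >= j! * j ^ j], dividing by [q ^+ j] bounds [kappa] by [C * (B / q) ^+ j / j!],
    which tends to 0. *)
Lemma superexponential_le0 (kappa C B q : R) (j0 : nat) : 0 <= C -> 0 <= B -> 0 < q ->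
  (forall j, (j0 <= j)%N -> (0 < j)%N ->
    kappa * q ^+ j <= C * (B ^+ j * (j%:R ^+ j / (j + j)`!%:R))) ->
  kappa <= 0.
Proof.
move=> C0 B0 q0 H.
have cv : C * exp_coeff (B / q) j @[j --> \oo] --> C * 0.
  by apply: cvgMr; exact: cvg_exp_coeff.
rewrite mulr0 in cv; apply: (cvgr_to_ge cv).
exists j0.+1 => // j /= j0j.
have jpos : (0 < j)%N by rewrite (leq_trans _ j0j).
rewrite -(ler_pM2r (exprn_gt0 j q0)); apply: le_trans (H j _ jpos) _; first exact: ltnW.
rewrite exp_coeffE exprMn exprVn -!mulrA ler_wpM2l//.
rewrite [X in _ <= X](_ : _ = B ^+ j * j`!%:R^-1); last first.
  by field; rewrite expf_neq0 ?gt_eqF// pnatr_eq0 -lt0n fact_gt0.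
rewrite ler_wpM2l ?exprn_ge0// ler_pdivrMr ?ltr0n ?fact_gt0//.
rewrite ler_pdivlMl ?ltr0n ?fact_gt0// -natrX -natrM ler_nat.
exact: fact_mul_expn_le.
Qed.

(** Baire's theorem: if no [E n] contained a ball, the complements would be dense open sets, and a
    point common to all of them would be covered by no [E n]. *)
Lemma closed_cover_ball (E : (set R)^nat) : (forall n, closed (E n)) ->
  (forall r, exists n, E n r) ->
  exists n c (e : R), 0 < e /\ forall r, `|c - r| < e -> E n r.
Proof.
move=> cE covE; apply: contrapT => H.
have : dense (\bigcap_n (~` E n)).
  apply: Baire => n; split; first exact: closed_openC.
  move=> O [x Ox] oO; apply: contrapT => /nonemptyPn OE0.
  have /nbhs_ballP[e e0 xe] : nbhs x O by exact: open_nbhs_nbhs.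
  apply: H; exists n, x, e; split=> // r xr.
  apply: contrapT => Er.
  have : (O `&` ~` E n) r by split=> //; apply: xe.
  by rewrite OE0.
move=> /(_ setT) []; first by exists 0.
  exact: openT.
by move=> r [_ Fr]; have [n Enr] := covE r; apply: (Fr n).
Qed.

Lemma continuous_iter_dif (H : R -> R -> R[i]) h k :
  (forall s, continuous (fun r => complex.Re (H r s))) ->
  (forall s, continuous (fun r => complex.Im (H r s))) ->
  forall s, continuous (fun r => complex.Re (iter k (dif h) (H r) s)) /\
            continuous (fun r => complex.Im (iter k (dif h) (H r) s)).
Proof.
move=> cR cI; elim: k => [|k IH] s /=; first by split.
have [R1 I1] := IH s; have [R2 I2] := IH (s + h).
split; rewrite /dif.
  rewrite (_ : (fun r => _) = (fun r => complex.Re (iter k (dif h) (H r) (s + h)) -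
    complex.Re (iter k (dif h) (H r) s))).
    by move=> r; apply: cvgB; [exact: R2|exact: R1].
  by apply/funext => r; case: (iter _ _ _ _) => ? ?; case: (iter _ _ _ _).
rewrite (_ : (fun r => _) = (fun r => complex.Im (iter k (dif h) (H r) (s + h)) -
  complex.Im (iter k (dif h) (H r) s))).
  by move=> r; apply: cvgB; [exact: I2|exact: I1].
by apply/funext => r; case: (iter _ _ _ _) => ? ?; case: (iter _ _ _ _).
Qed.

(** An intersection of closed conditions on [r], one for each order, step and point, since a finite
    difference involves finitely many values of [H r]. *)
Lemma closed_bandlim (H : R -> R -> R[i]) M N :
  (forall s, continuous (fun r => complex.Re (H r s))) ->
  (forall s, continuous (fun r => complex.Im (H r s))) ->
  closed [set r | bandlim M N (H r)].
Proof.
move=> cR cI.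
rewrite (_ : [set r | _] = \bigcap_(q in [set: nat * R * R])
  [set r | nc (iter q.1.1 (dif q.1.2) (H r) q.2) <= M * (N * `|q.1.2|) ^+ q.1.1]).
  apply: closed_bigI => -[[k h] s] _ /=.
  have [cR' cI'] := continuous_iter_dif h k cR cI s.
  pose g r := Num.sqrt (complex.Re (iter k (dif h) (H r) s) ^+ 2 +
    complex.Im (iter k (dif h) (H r) s) ^+ 2).
  rewrite (_ : [set r | _] = g @^-1` [set y | y <= M * (N * `|h|) ^+ k]).
    apply: preimage_closed => [r _|]; last exact: closed_le.
    apply: continuous_comp; last exact: sqrt_continuous.
    by apply: cvgD; rewrite expr2; apply: cvgM; [exact: cR'|exact: cR'|exact: cI'|exact: cI'].
  by apply/seteqP; split => r /=; rewrite /g; case: (iter _ _ _ _).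
apply/seteqP; split => [r Hr [[k h] s] _ //=|r Hr k h s].
exact: (Hr (k, h, s)).
Qed.

End midpoint.

Section midpoint_core.
Context {R : realType}.

Variables (psi : R -> R) (f : R -> R[i]).
Hypothesis psi_cont : continuous psi.
Hypothesis psiQ : forall r : R, exists M N : R,
  0 <= N /\ bandlim M N (fun s => expi (r * psi s) * f s).

Let H (r s : R) := expi (r * psi s) * f s.

(** The sets of those [r] for which the integer [n] serves as both constants are closed and cover
    the line, so one of them contains an interval. *)
Lemma uniform_bandlim : exists (a b N : R), [/\ a < b, 0 <= N &
  forall r, a <= r <= b -> bandlim N N (H r)].
Proof.
have cR s : continuous (fun r => complex.Re (H r s)).
  rewrite (_ : (fun r => _) = (fun r => cos (r * psi s) * complex.Re (f s) -
      sin (r * psi s) * complex.Im (f s))).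
    move=> r; apply: cvgB; apply: cvgMl; apply: continuous_comp.
    - exact: cvgMl.
    - exact: continuous_cos.
    - exact: cvgMl.
    - exact: continuous_sin.
  by apply/funext => r; rewrite /H; case: (f s).
have cI s : continuous (fun r => complex.Im (H r s)).
  rewrite (_ : (fun r => _) = (fun r => cos (r * psi s) * complex.Im (f s) +
      sin (r * psi s) * complex.Re (f s))).
    move=> r; apply: cvgD; apply: cvgMl; apply: continuous_comp.
    - exact: cvgMl.
    - exact: continuous_cos.
    - exact: cvgMl.
    - exact: continuous_sin.
  by apply/funext => r; rewrite /H; case: (f s).
have [||n [c [e [e0 HE]]]] := @closed_cover_ball R
    (fun n => [set r | bandlim n%:R n%:R (H r)]).
- by move=> n; exact: closed_bandlim.
- move=> r; have [M [N [N0 HQ]]] := psiQ r.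
  have M0 := bandlim_ge0 HQ.
  exists (Num.truncn (M + N)).+1 => /=.
  have MN : M + N <= (Num.truncn (M + N)).+1%:R by exact/ltW/truncnS_gt.
  by apply: bandlim_le HQ => //; apply: le_trans MN; rewrite ?lerDl ?lerDr.
(* Half the radius, as the interval is closed and the ball open. *)
exists (c - e / 2), (c + e / 2), n%:R; split => //; first lra.
by move=> r /andP[r1 r2]; apply: HE; rewrite ltr_norml; lra.
Qed.

Let D s := psi s + psi (- s) - 2 * psi 0.
Let k s := f s * f (- s).

(* [D] is the second symmetric difference of [psi] at [0]; the expression below
   is a [j]-th finite difference in the frequency [r] of
   [expi (r * psi s) * f s * (expi (r * psi (- s)) * f (- s))]. *)
Let W (a w : R) (j : nat) s :=
  expi (a * D s) * (expi (w * D s / j%:R) - 1) ^+ j * k s.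

(** The binomial theorem turns [W] into a combination of the products [H (r l) s * H (r l) (- s)] at
    [j.+1] equally spaced frequencies in [a, b]. The coefficients have modulus ['C(j, l)], with sum
    [2 ^+ j]. *)
Let bandlimW a b N j : a < b -> 0 <= N ->
  (forall r, a <= r <= b -> bandlim N N (H r)) -> (0 < j)%N ->
  bandlim (2 ^+ j * N ^+ 2) (N + N) (W a (b - a) j).
Proof.
move=> ab N0 HQ j0.
pose r (l : nat) := a + l%:R * ((b - a) / j%:R).
have jn0 : 0 < j%:R :> R by rewrite ltr0n.
have rab (l : 'I_j.+1) : a <= r l <= b.
  rewrite /r lerDl mulr_ge0 ?divr_ge0 ?subr_ge0 ?(ltW ab)//=.
  have lj : l%:R <= j%:R :> R by rewrite ler_nat -ltnS.
  rewrite -[leRHS](subrKC a) lerD2l mulrCA ler_piMr ?subr_ge0 ?(ltW ab)//.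
  by rewrite ler_pdivrMr// mul1r.
(* The unimodular factor supplies the term [- 2 * psi 0] of [D], which the products of values of [H]
   lack. *)
pose c (l : nat) : R[i] := ((-1) ^+ (j - l) *+ 'C(j, l)) * expi (- (r l) * (2 * psi 0)).
have cN (l : 'I_j.+1) : nc (c l) = 'C(j, l)%:R.
  by rewrite /c ncM nc_expi mulr1 ncMn ncX ncN nc1 expr1n.
rewrite (_ : 2 ^+ j = \sum_(l < j.+1) nc (c l)); last first.
  under eq_bigr do rewrite cN.
  rewrite -natr_sum -natrX; congr (_%:R).
  by rewrite (Pascal 1 1); apply: eq_bigr => i _; rewrite !exp1n !muln1.
rewrite mulr_suml.
rewrite (_ : W a (b - a) j = fun s =>
    \sum_(l < j.+1) c l * (H (r l) s * H (r l) (- s))); last first.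
  apply/funext => s; rewrite /W addrC exprDn mulr_sumr mulr_suml.
  apply: eq_bigr => l _; rewrite -expiMn /c /H /k.
  have -> : expi (- (r l) * (2 * psi 0)) = expi (a * D s) *
      expi ((b - a) * D s / j%:R *+ l) *
      expi (- (r l * psi s)) * expi (- (r l * psi (- s))).
    rewrite -!expiD; congr expi; rewrite -mulr_natr /r /D; ring.
  have E (x : R) : expi (- x) * expi x = 1 by rewrite -expiD addNr expi0.
  rewrite -mulr_natr.
  transitivity ((-1) ^+ (j - l) * 'C(j, l)%:R * expi (a * D s) *
    expi ((b - a) * D s / j%:R *+ l) *
    (expi (- (r l * psi s)) * expi (r l * psi s)) *
    (expi (- (r l * psi (- s))) * expi (r l * psi (- s))) * (f s * f (- s))).
    by rewrite !E; ring.
  by rewrite -(mulr_natr (_ ^+ (j - l))); ring.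
apply: bandlim_sum => l; apply: bandlimZ; rewrite expr2; apply: bandlimM => //.
  exact: HQ.
by apply: bandlim_opp; exact: HQ.
Qed.

(** If [D 1 != 0], then for large [j] the modulus of [W] at 1 is at least
    [(q / j%:R) ^+ j * nc (k 1)], which outgrows the bound that [bandlim_flat] gives at order
    [j + j]. *)
Lemma midpoint_affine : f 0 != 0 -> f 1 != 0 -> f (-1) != 0 ->
  psi 1 + psi (-1) = 2 * psi 0.
Proof.
move=> f0 f1 fN1; have [a [b [N [ab N0 HQ]]]] := uniform_bandlim.
pose w := b - a; have w0 : 0 < w by rewrite subr_gt0.
pose k0 := nc (k 0).
have k0_gt0 : 0 < k0 by rewrite nc_gt0 /k oppr0 mulf_neq0.
(* [P] has the modulus of [k] and a controlled type, so it yields bounds on [nc (k s)]. *)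
pose P s := H a s * H a (- s).
have PQ : bandlim (N * N) (N + N) P.
  by apply: bandlimM => //; [|apply: bandlim_opp]; apply: HQ; rewrite lexx ltW.
have ncP s : nc (P s) = nc (k s).
  by rewrite /P /H /k !ncM !nc_expi !mul1r.
have k_le s : nc (k s) <= N ^+ 2.
  by rewrite -ncP; have := PQ 0%N 0 s; rewrite expr0 mulr1 expr2.
have D0 : D 0 = 0 by rewrite /D oppr0; ring.
(* A Lipschitz constant of [P], from its first differences; it keeps [nc (k s)] above half of [k0]
   near 0. *)
pose K := N * N * (N + N).
have K0 : 0 <= K by rewrite !mulr_ge0// addr_ge0.
have k_ge s : `|s| < k0 / 2 / (K + 1) -> k0 / 2 <= nc (k s).
  move=> sK; have := PQ 1%N s 0; rewrite /= /dif add0r expr1 mulrA -/K => Pd.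
  have K1 : 0 < K + 1 by rewrite ltr_wpDl.
  have {}sK : K * `|s| <= k0 / 2.
    apply: (@le_trans _ _ ((K + 1) * `|s|)); first by rewrite ler_wpM2r// lerDl.
    by rewrite mulrC -ler_pdivlMr// ltW.
  have := ncD (P s) (- (P s - P 0)).
  have -> : P s + - (P s - P 0) = P 0 by ring.
  by rewrite ncN !ncP -/k0; lra.
have WN j s : (0 < j)%N -> nc (W a w j s) =
    nc (expi (w * D s / j%:R) - 1) ^+ j * nc (k s).
  by move=> j0; rewrite /W !ncM nc_expi mul1r ncX.
(* Continuity of [psi] keeps the angle in the range where the chord is at least half the angle. *)
have [eta2 [eta20 D_le1]] : exists eta, 0 < eta /\ forall s, `|s| < eta -> `|w * D s| <= 1.
  have cD : (fun s => w * D s) @ 0 --> w * D 0.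
    apply: cvgMr; apply: cvgB; last exact: cvg_cst.
    apply: cvgD; first exact: psi_cont.
    apply: continuous_comp; first exact: opp_continuous.
    exact: psi_cont.
  rewrite D0 mulr0 in cD.
  move/cvgr0Pnorm_le : cD => /(_ 1 ltr01) /nbhs_ballP[e e0 He].
  exists e; split=> // s se; apply: He.
  by rewrite /ball/= sub0r normrN.
pose eta := Num.min (k0 / 2 / (K + 1)) eta2.
have eta0 : 0 < eta by rewrite lt_min eta20 divr_gt0// ?divr_gt0// ltr_wpDl.
pose C2 := 4 * (N ^+ 2 * (N + N) ^+ 2) / k0.
have C20 : 0 <= C2.
  apply: divr_ge0; last exact: ltW.
  by apply: mulr_ge0 => //; apply: mulr_ge0; exact: sqr_ge0.
(* [psi] may fail to be smooth, so the quadratic bound is read off [W] with [j = 1]: this function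
   is even and vanishes at 0, so its second difference around 0 is twice its value at [s]. Dividing
   out [nc (k s) >= k0 / 2] and the chord bound gives [C2]. *)
have D_quad s : `|s| < eta -> `|w * D s| <= C2 * `|s| ^+ 2.
  rewrite lt_min => /andP[s1 s2].
  have WQ := @bandlimW a b N 1 ab N0 HQ isT.
  have := WQ 2%N s (- s).
  rewrite /= /dif !addNr add0r.
  have -> : W a (b - a) 1 0 = 0 by rewrite /W D0 !mulr0 mul0r expi0 subrr expr1 mulr0 mul0r.
  have -> : W a (b - a) 1 (- s) = W a (b - a) 1 s.
    rewrite /W; have -> : D (- s) = D s by rewrite /D opprK (addrC (psi (- s))).
    by rewrite /k opprK (mulrC (f (- s))).
  rewrite sub0r subr0 opprK -mulr2n ncMn WN// expr1 divr1 exprMn => H2.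
  have := nc_expi_sub1_ge (D_le1 _ s2); have := k_ge _ s1.
  set A := nc (expi _ - 1) in H2 *; set B := nc (k s) in H2 *; set d := `|w * D s|.
  move=> kB dA.
  have : (d / 2) * (k0 / 2) <= A * B by apply: ler_pM => //; rewrite divr_ge0 ?normr_ge0 ?(ltW k0_gt0).
  rewrite /C2; set Z := N ^+ 2 * _; move=> dk.
  have : d * k0 <= 4 * Z * `|s| ^+ 2.
    move: H2; rewrite mulr2n expr1 -/w.
    rewrite [X in _ <= X](_ : _ = 2 * Z * `|s| ^+ 2); last by rewrite /Z; ring.
    by move=> H2; lra.
  rewrite -ler_pdivlMr// => /le_trans; apply.
  by rewrite le_eqVlt; apply/orP; left; apply/eqP; ring.
clearbody C2.
apply/eqP; rewrite -subr_eq0 -/(D 1); apply/eqP; apply: contrapT => /eqP D1.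
pose k1 := nc (k 1); have k1_gt0 : 0 < k1 by rewrite nc_gt0 /k mulf_neq0.
suff : k1 <= 0 by rewrite leNgt k1_gt0.
pose q := `|w * D 1| / 2.
have q0 : 0 < q by rewrite divr_gt0// normr_gt0 mulf_neq0// gt_eqF.
pose y := (N + N) * `|1 : R|.
have y0 : 0 <= y by rewrite mulr_ge0// addr_ge0.
(* The threshold on [j] brings [w * D 1 / j] into [-1, 1], as the lower bound on chords requires. *)
apply: (@superexponential_le0 _ _ (N ^+ 2 * expR y) (2 * y ^+ 2) q
  (Num.truncn `|w * D 1|).+1) => //.
- by rewrite mulr_ge0 ?sqr_ge0// expR_ge0.
- by rewrite mulr_ge0 ?sqr_ge0.
move=> j jbig j0.
have jn0 : 0 < j%:R :> R by rewrite ltr0n.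
have NN0 : 0 <= N + N by rewrite addr_ge0.
(* Each of the [j] chord factors of [W] is quadratically small at 0, hence flatness of order
   [j + j]. *)
have := @bandlim_flat R _ _ (C2 ^+ j * N ^+ 2) eta (j + j) _ 1 NN0
  (mulr_ge0 (exprn_ge0 _ C20) (sqr_ge0 _)) eta0 (@bandlimW a b N j ab N0 HQ j0).
rewrite -/w => /(_ _)/wrap[] => [s se|].
  rewrite WN//.
  have -> : C2 ^+ j * N ^+ 2 * `|s| ^+ (j + j) = (C2 * `|s| ^+ 2) ^+ j * N ^+ 2.
    by rewrite exprMn -exprM mul2n -addnn mulrAC.
  apply: ler_pM; rewrite ?exprn_ge0 ?nc_ge0 ?sqr_ge0//.
  rewrite lerXn2r ?nnegrE ?nc_ge0 ?mulr_ge0 ?sqr_ge0//.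
  apply: le_trans (nc_expi_sub1_le _) _; apply: le_trans (D_quad _ se).
  rewrite normrM normfV normr_nat ler_pdivrMr// ler_peMr// ler1n//.
rewrite WN// -/k1 -/y => upper.
have lower : q / j%:R <= nc (expi (w * D 1 / j%:R) - 1).
  have := @nc_expi_sub1_ge R (w * D 1 / j%:R).
  rewrite normrM normfV normr_nat /q mulrAC; apply.
  rewrite ler_pdivrMr// mul1r ltW//; apply: lt_le_trans (truncnS_gt _) _.
  by rewrite ler_nat.
have : (q / j%:R) ^+ j * k1 <= 2 ^+ j * N ^+ 2 * (y ^+ (j + j) / (j + j)`!%:R * expR y).
  apply: le_trans upper; rewrite ler_wpM2r ?(ltW k1_gt0)// lerXn2r// nnegrE ?nc_ge0//.
  by rewrite divr_ge0 ?(ltW q0).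
rewrite exprMn exprVn mulrAC ler_pdivrMr ?exprn_gt0// mulrC => /le_trans; apply.
rewrite exprD [in leRHS]exprMn -exprM mul2n -addnn exprD.
by rewrite le_eqVlt; apply/orP; left; apply/eqP; ring.
Qed.

End midpoint_core.

(** * Integration over R^d *)

Section euclidean.
Context {R : realType}.

Lemma measurable_linear_cV d (v : 'cV[R]_d) :
  measurable_fun [set: 'cV[R]_d] (fun u => dotv u v).
Proof.
apply: measurable_sum => i.
by apply: measurable_funM => //; exact: measurable_coord_cV.
Qed.

Lemma measurable_mulmx_cV m n (X : 'M[R]_(m, n)) :
  measurable_fun [set: 'cV[R]_n] (fun u => X *m u).
Proof.
apply: measurable_fun_cVP => i.
rewrite (_ : (fun u => _) = (fun u : 'cV[R]_n => \sum_j X i j * u j ord0)); last first.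
  by apply/funext => u; rewrite mxE.
apply: measurable_sum => j.
by apply: measurable_funM => //; exact: measurable_coord_cV.
Qed.

Lemma measurable_translate_cV n (c : 'cV[R]_n) :
  measurable_fun [set: 'cV[R]_n] (fun u => u + c).
Proof.
apply: measurable_fun_cVP => i.
rewrite (_ : (fun u => _) = (fun u : 'cV[R]_n => u i ord0 + c i ord0)); last first.
  by apply/funext => u; rewrite mxE.
by apply: measurable_funD => //; exact: measurable_coord_cV.
Qed.

Lemma measurable_eball d (c : 'cV[R]_d) (r : R) : measurable (eball c r).
Proof.
pose f (u : 'cV[R]_d) := \sum_i (u i ord0 - c i ord0) * (u i ord0 - c i ord0).
have mf : measurable_fun setT f.
  apply: measurable_sum => i.
  by apply: measurable_funM; apply: measurable_funB => //; exact: measurable_coord_cV.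
rewrite (_ : eball c r = f @^-1` `]-oo, r ^+ 2[).
  by rewrite -[X in measurable X]setTI; exact: mf.
apply/seteqP; split => u; rewrite /eball/= in_itv/= /f /dotv.
  by under eq_bigr do rewrite !mxE.
by under [X in _ -> X < _]eq_bigr do rewrite !mxE.
Qed.

Lemma eball_coord d (c u : 'cV[R]_d) (r : R) i : 0 < r -> eball c r u ->
  `|u i ord0 - c i ord0| < r.
Proof.
move=> r0; rewrite /eball/= /dotv => ur.
rewrite -(ltr_pXn2r (n := 2))// ?nnegrE ?(ltW r0)//.
rewrite real_normK ?num_real//; apply: le_lt_trans ur.
rewrite (bigD1 i)//= !mxE -expr2 lerDl; apply: sumr_ge0 => j _.
by rewrite -expr2 sqr_ge0.
Qed.

Lemma eball_dotv_bounded d (c v : 'cV[R]_d) (r : R) : 0 < r ->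
  exists2 N, 0 <= N & forall u, eball c r u -> `|dotv u v| <= N.
Proof.
move=> r0; exists (\sum_i (`|c i ord0| + r) * `|v i ord0|).
  by apply: sumr_ge0 => i _; rewrite mulr_ge0// addr_ge0// ltW.
move=> u ur; apply: le_trans (ler_norm_sum _ _ _) _; apply: ler_sum => i _.
rewrite normrM ler_wpM2r//; have := eball_coord i r0 ur.
move=> /ltW h; rewrite -[u i ord0](subrK (c i ord0)).
by rewrite (le_trans (ler_normD _ _))// addrC lerD2l.
Qed.

Lemma lebesgue_cV_bounded d (A : set 'cV[R]_d) (K : R) : measurable A ->
  (forall u, A u -> forall i, `|u i ord0| <= K) -> (lebesgue_cV d A < +oo)%E.
Proof.
move=> mA AK.
pose B := [set x : 'cV[R]_d | forall i, `[-K, K]%classic (x i ord0)].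
have BE : lebesgue_cV d B = (\prod_(i < d) lebesgue_measure (`[(-K)%R, K] : set R))%E.
  exact: (lebesgue_cV_box (A := fun=> `[-K, K]%classic)).
have mB : measurable B.
  rewrite (_ : B = \bigcap_(i in [set: 'I_d])
      ((fun x : 'cV[R]_d => x i ord0) @^-1` `[-K, K]%classic)).
    apply: fin_bigcap_measurable => // i _.
    by rewrite -[X in measurable X]setTI; exact: measurable_coord_cV.
  by apply/seteqP; split => x /= Bx i => [_|]; exact: Bx.
apply: (@le_lt_trans _ _ (lebesgue_cV d B)).
  apply: le_measure; rewrite ?inE// => u Au i /=.
  by rewrite in_itv/= -ler_norml; exact: AK.
rewrite BE; suff fin : (\prod_(i < d) lebesgue_measure (`[(-K)%R, K] : set R))%E \is a fin_num.
  by rewrite -(fineK fin) ltry.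
elim/big_ind: _ => // [x y xfin yfin|i _]; first by rewrite fin_numM.
by rewrite lebesgue_measure_itv/=; case: ifP.
Qed.

Lemma eball_bounded d (c : 'cV[R]_d) (r : R) : 0 < r ->
  exists K, forall u, eball c r u -> forall i, `|u i ord0| <= K.
Proof.
move=> r0; exists (\sum_i (`|c i ord0| + r)) => u ur i.
rewrite (bigD1 i)//= -[u i ord0](subrK (c i ord0)).
rewrite (le_trans (ler_normD _ _))// [leLHS]addrC -addrA lerD2l.
rewrite (le_trans (ltW (eball_coord i r0 ur)))// lerDl.
by apply: sumr_ge0 => j _; rewrite addr_ge0// ltW.
Qed.

Lemma eball_finite d (c : 'cV[R]_d) (r : R) : 0 < r ->
  (lebesgue_cV d (eball c r) < +oo)%E.
Proof.
move=> r0; have [K cK] := eball_bounded c r0.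
by apply: lebesgue_cV_bounded cK; exact: measurable_eball.
Qed.

Lemma bounded_sub_eball d (A : set 'cV[R]_d) (K : R) :
  (forall u, A u -> forall i, `|u i ord0| <= K) ->
  exists2 r, 0 < r & A `<=` eball 0 r.
Proof.
(* The summand 1 keeps the radius positive and the inequality strict when [K] or [d] is 0. *)
move=> AK; exists (1 + \sum_(i < d) `|K|).
  by rewrite ltr_pwDl// sumr_ge0.
move=> u Au; rewrite /eball/= subr0 /dotv.
have S0 : 0 <= \sum_(i < d) `|K| by exact: sumr_ge0.
apply: (@le_lt_trans _ _ ((\sum_(i < d) `|K|) ^+ 2)); last first.
  by rewrite ltrXn2r ?nnegrE// ?addr_ge0// ltrDr.
apply: (@le_trans _ _ (\sum_(i < d) `|K| * \sum_(j < d) `|K|)).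
  apply: ler_sum => i _; rewrite -expr2 -real_normK ?num_real// expr2.
  have uK : `|u i ord0| <= `|K| by rewrite (le_trans (AK _ Au i))// ler_norm.
  apply: ler_pM => //; apply: le_trans uK _.
  by rewrite (bigD1 i)//= lerDl sumr_ge0.
by rewrite -mulr_suml expr2.
Qed.

End euclidean.

(** * Complex-valued integrals *)

Section complex_integral.
Context {R : realType} (d : nat).
Implicit Types (D : set 'cV[R]_d) (g h : 'cV[R]_d -> R[i]) (w : 'cV[R]_d -> R).

Local Notation mu := (lebesgue_cV d).

Definition cmeasurable h := measurable_fun setT (fun u => complex.Re (h u)) /\
  measurable_fun setT (fun u => complex.Im (h u)).

Definition cintegrable D h := mu.-integrable D (EFin \o (fun u => complex.Re (h u))) /\
  mu.-integrable D (EFin \o (fun u => complex.Im (h u))).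

Lemma cmeasurableM g h : cmeasurable g -> cmeasurable h ->
  cmeasurable (fun u => g u * h u).
Proof.
move=> [gR gI] [hR hI]; split.
  rewrite (_ : (fun u => _) = (fun u => complex.Re (g u) * complex.Re (h u) -
    complex.Im (g u) * complex.Im (h u))).
    by apply: measurable_funB; apply: measurable_funM.
  by apply/funext => u; case: (g u) (h u) => ? ? [].
rewrite (_ : (fun u => _) = (fun u => complex.Re (g u) * complex.Im (h u) +
  complex.Im (g u) * complex.Re (h u))).
  by apply: measurable_funD; apply: measurable_funM.
by apply/funext => u; case: (g u) (h u) => ? ? [].
Qed.

Lemma cmeasurableD g h : cmeasurable g -> cmeasurable h ->
  cmeasurable (fun u => g u + h u).
Proof.
move=> [gR gI] [hR hI]; split.
  rewrite (_ : (fun u => _) = (fun u => complex.Re (g u) + complex.Re (h u))).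
    exact: measurable_funD.
  by apply/funext => u; case: (g u) (h u) => ? ? [].
rewrite (_ : (fun u => _) = (fun u => complex.Im (g u) + complex.Im (h u))).
  exact: measurable_funD.
by apply/funext => u; case: (g u) (h u) => ? ? [].
Qed.

Lemma cmeasurable_cst c : cmeasurable (fun=> c).
Proof. by split; exact: measurable_cst. Qed.

Lemma cmeasurableX h k : cmeasurable h -> cmeasurable (fun u => h u ^+ k).
Proof.
move=> mh; elim: k => [|k IH]; first exact: cmeasurable_cst.
under eq_fun do rewrite exprS.
exact: cmeasurableM.
Qed.

Lemma cmeasurable_expi w : measurable_fun setT w -> cmeasurable (fun u => expi (w u)).
Proof.
move=> mw; split => /=.
  by apply: measurableT_comp => //; apply: continuous_measurable_fun; exact: continuous_cos.
by apply: measurableT_comp => //; apply: continuous_measurable_fun; exact: continuous_sin.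
Qed.

Lemma cmeasurable_nc h : cmeasurable h -> measurable_fun setT (fun u => nc (h u)).
Proof.
move=> [hR hI].
rewrite (_ : (fun u => _) = (fun u => Num.sqrt (complex.Re (h u) ^+ 2 + complex.Im (h u) ^+ 2))).
  apply: measurableT_comp; first by apply: continuous_measurable_fun; exact: sqrt_continuous.
  by apply: measurable_funD; apply: measurable_funX.
by apply/funext => u; case: (h u).
Qed.

Lemma cintegrable_dom D h w : measurable D -> cmeasurable h ->
  mu.-integrable D (EFin \o w) -> (forall u, D u -> nc (h u) <= w u) ->
  cintegrable D h.
Proof.
move=> mD [hR hI] iw hw; split; apply: (le_integrable mD _ _ iw).
- by apply/measurable_EFinP; exact: measurable_funS hR.
- move=> u Du; rewrite /= lee_fin; apply: le_trans (normr_Re_le _) _.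
  by apply: le_trans (hw u Du) _; exact: ler_norm.
- by apply/measurable_EFinP; exact: measurable_funS hI.
- move=> u Du; rewrite /= lee_fin; apply: le_trans (normr_Im_le _) _.
  by apply: le_trans (hw u Du) _; exact: ler_norm.
Qed.

(** The factor 2 comes from estimating real and imaginary parts separately; it is harmless where
    only the existence of a bound, or a limit 0, is at stake. *)
Lemma nc_cintegral_le D h w : measurable D -> cmeasurable h ->
  mu.-integrable D (EFin \o w) -> (forall u, D u -> nc (h u) <= w u) ->
  nc (cintegral D h) <= 2 * \int[mu]_(u in D) w u.
Proof.
move=> mD mh iw hw; have [iR iI] := cintegrable_dom mD mh iw hw.
apply: le_trans (nc_le_ReIm _) _ => /=.
have iabs (f : 'cV[R]_d -> R) : mu.-integrable D (EFin \o f) ->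
    mu.-integrable D (EFin \o (fun u => `|f u|)).
  by move=> /integrable_abse.
rewrite mulrDl mul1r; apply: lerD; apply: le_trans (le_normr_Rintegral mD _) _ => //.
  apply: le_Rintegral => //; first exact: iabs.
  by move=> u Du; apply: le_trans (normr_Re_le _) _; exact: hw.
apply: le_Rintegral => //; first exact: iabs.
by move=> u Du; apply: le_trans (normr_Im_le _) _; exact: hw.
Qed.

Lemma eq_cintegral D g h : (forall u, D u -> g u = h u) ->
  cintegral D g = cintegral D h.
Proof.
move=> gh; rewrite /cintegral; congr (_ +i* _).
  by apply: eq_Rintegral => u /set_mem Du; rewrite gh.
by apply: eq_Rintegral => u /set_mem Du; rewrite gh.
Qed.

Lemma cintegralD D g h : measurable D -> cintegrable D g -> cintegrable D h ->
  cintegral D (fun u => g u + h u) = cintegral D g + cintegral D h.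
Proof.
move=> mD [gR gI] [hR hI]; rewrite /cintegral.
have -> : (fun u => complex.Re (g u + h u)) = (fun u => complex.Re (g u) + complex.Re (h u)).
  by apply/funext => u; case: (g u) (h u) => ? ? [].
have -> : (fun u => complex.Im (g u + h u)) = (fun u => complex.Im (g u) + complex.Im (h u)).
  by apply/funext => u; case: (g u) (h u) => ? ? [].
by rewrite !RintegralD.
Qed.

Lemma cintegralZ D (c : R[i]) h : measurable D -> cintegrable D h ->
  cintegral D (fun u => c * h u) = c * cintegral D h.
Proof.
move=> mD [hR hI]; rewrite /cintegral; case: c => a b.
have iZ (r : R) f : mu.-integrable D (EFin \o f) ->
    mu.-integrable D (EFin \o (fun u => r * f u)).
  by move=> /(integrableZl mD r); apply: eq_integrable.
have -> : (fun u => complex.Re ((a +i* b) * h u)) =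
    (fun u => a * complex.Re (h u) - b * complex.Im (h u)).
  by apply/funext => u; case: (h u).
have -> : (fun u => complex.Im ((a +i* b) * h u)) =
    (fun u => a * complex.Im (h u) + b * complex.Re (h u)).
  by apply/funext => u; case: (h u).
by rewrite RintegralB ?RintegralD ?RintegralZl//; apply: iZ.
Qed.

Lemma cintegralB D g h : measurable D -> cintegrable D g -> cintegrable D h ->
  cintegral D (fun u => g u - h u) = cintegral D g - cintegral D h.
Proof.
move=> mD [gR gI] [hR hI]; rewrite /cintegral.
have -> : (fun u => complex.Re (g u - h u)) = (fun u => complex.Re (g u) - complex.Re (h u)).
  by apply/funext => u; case: (g u) (h u) => ? ? [].
have -> : (fun u => complex.Im (g u - h u)) = (fun u => complex.Im (g u) - complex.Im (h u)).
  by apply/funext => u; case: (g u) (h u) => ? ? [].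
by rewrite !RintegralB.
Qed.

Lemma L2_cmeasurable g : L2 g -> cmeasurable g.
Proof. by case. Qed.

(** [1 + |g|^2] serves throughout as an integrable majorant of [|g|] on a ball. *)
Lemma L2_weight_integrable g D : L2 g -> measurable D -> (mu D < +oo)%E ->
  mu.-integrable D (EFin \o (fun u => 1 + nc (g u) ^+ 2)).
Proof.
move=> [gR gI gfin] mD Dfin.
have mn : measurable_fun setT (fun u => nc (g u) ^+ 2).
  by apply: measurable_funX; apply: cmeasurable_nc.
have i1 : mu.-integrable D (EFin \o cst 1%R).
  apply/integrableP; split; first exact/measurable_EFinP.
  under eq_integral do rewrite /= normr1.
  by rewrite integral_cst// mul1e.
have i2 : mu.-integrable D (EFin \o (fun u => nc (g u) ^+ 2)).
  apply/integrableP; split.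
    by apply/measurable_EFinP; exact: measurable_funS mn.
  apply: le_lt_trans gfin.
  under eq_integral do rewrite /= ger0_norm ?sqr_ge0//.
  apply: ge0_subset_integral => //; first by apply/measurable_EFinP.
  by move=> u _; rewrite lee_fin sqr_ge0.
exact: (integrableD mD i1 i2).
Qed.

Lemma nc_le_weight (z : R[i]) : nc z <= 1 + nc z ^+ 2.
Proof.
have := sqr_ge0 (nc z - 1); have := nc_ge0 z; rewrite sqrrB1.
by rewrite mulr2n; have := sqr_ge0 (nc z); lra.
Qed.

End complex_integral.

(** * Restriction of Paley-Wiener functions to lines *)

Section paley_wiener_lines.
Context {R : realType} (d : nat).
Local Notation mu := (lebesgue_cV d).

Lemma dotvDr (u x y : 'cV[R]_d) : dotv u (x + y) = dotv u x + dotv u y.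
Proof.
by rewrite /dotv -big_split; apply: eq_bigr => i _; rewrite mxE mulrDr.
Qed.

Lemma dotvZr (u x : 'cV[R]_d) s : dotv u (s *: x) = s * dotv u x.
Proof. by rewrite /dotv mulr_sumr; apply: eq_bigr => i _; rewrite mxE mulrCA. Qed.

Lemma dotvC (u v : 'cV[R]_d) : dotv u v = dotv v u.
Proof. by rewrite /dotv; apply: eq_bigr => i _; rewrite mulrC. Qed.

(** A difference of step [h] along [v] multiplies the integrand by [expi (h * dotv u v) - 1], whose
    modulus is at most [N * |h|] on the ball. *)
Lemma PW_line_bandlim (F : 'cV[R]_d -> R[i]) (t0 v : 'cV[R]_d) : PW F ->
  exists M N, 0 <= N /\ bandlim M N (fun s => F (t0 + s *: v)).
Proof.
move=> [g [c [r [gL2 r0 FE]]]]; set B := eball c r in FE.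
have mB : measurable B by exact: measurable_eball.
have [N N0 BN] := eball_dotv_bounded c v r0.
pose w (u : 'cV[R]_d) := 1 + nc (g u) ^+ 2.
have iw : mu.-integrable B (EFin \o w).
  by apply: L2_weight_integrable => //; exact: eball_finite.
exists (2 * \int[mu]_(u in B) w u), N; split => // k h s.
pose G k s u := g u * expi (dotv u (t0 + s *: v)) * (expi (h * dotv u v) - 1) ^+ k.
have mG j x : cmeasurable (G j x).
  apply: cmeasurableM; first apply: cmeasurableM.
  - exact: L2_cmeasurable.
  - by apply: cmeasurable_expi; exact: measurable_linear_cV.
  - apply: cmeasurableX; apply: cmeasurableD; last exact: cmeasurable_cst.
    apply: cmeasurable_expi; apply: measurable_funM => //.
    exact: measurable_linear_cV.
have Gw j x u : B u -> nc (G j x u) <= w u * (N * `|h|) ^+ j.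
  move=> Bu; rewrite /G !ncM nc_expi mulr1 ncX; apply: ler_pM.
  - exact: nc_ge0.
  - by rewrite exprn_ge0// nc_ge0.
  - exact: nc_le_weight.
  rewrite lerXn2r ?nnegrE ?nc_ge0 ?mulr_ge0//.
  apply: le_trans (nc_expi_sub1_le _) _.
  by rewrite normrM mulrC ler_wpM2r//; exact: BN.
have iZ a : mu.-integrable B (EFin \o (fun u => w u * a)).
  move: (integrableZl mB a iw); apply: eq_integrable => // u _ /=.
  by rewrite mulrC EFinM.
have iG j x : cintegrable B (G j x) by apply: cintegrable_dom (Gw j x).
have E j x : iter j (dif h) (fun s => F (t0 + s *: v)) x = cintegral B (G j x).
  elim: j x => [|j IH] x /=.
    by rewrite FE; apply: eq_cintegral => u _; rewrite /G expr0 mulr1.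
  rewrite /dif !IH -cintegralB//; apply: eq_cintegral => u _.
  rewrite /G.
  have -> : dotv u (t0 + (x + h) *: v) = dotv u (t0 + x *: v) + h * dotv u v.
    by rewrite scalerDl addrA (dotvDr _ (t0 + x *: v)) dotvZr.
  by rewrite expiD exprS; ring.
rewrite E; apply: le_trans (nc_cintegral_le _ _ (iZ _) (Gw k s)) _ => //.
by rewrite RintegralZr// mulrA.
Qed.

End paley_wiener_lines.

(** * Image measures, uniqueness and translation invariance of Lebesgue measure *)

Section pushforward_measure.
Context d1 d2 (T1 : measurableType d1) (T2 : measurableType d2) (R : realType).
Variables (mu : {measure set T1 -> \bar R}) (f : T1 -> T2).
Hypothesis mf : measurable_fun [set: T1] f.

Definition image_measure : {measure set T2 -> \bar R}.
Proof. by refine (pushforward mu f : {measure set T2 -> \bar R}). Defined.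

Lemma image_measureE A : image_measure A = mu (f @^-1` A).
Proof. by []. Qed.

Lemma measurable_preimage A : measurable A -> measurable (f @^-1` A).
Proof. by move=> mA; rewrite -[X in measurable X]setTI; exact: mf. Qed.

End pushforward_measure.

Section lebesgue_cV_unique.
Context {R : realType}.

Definition cbox n (A : 'I_n -> set R) : set 'cV[R]_n :=
  [set x | forall i, A i (x i ord0)].

Lemma measurable_cbox n (A : 'I_n -> set R) : (forall i, measurable (A i)) ->
  measurable (cbox A).
Proof.
move=> mA; rewrite (_ : cbox A = \bigcap_(i in [set: 'I_n])
    ((fun x : 'cV[R]_n => x i ord0) @^-1` A i)).
  apply: fin_bigcap_measurable => // i _.
  by rewrite -[X in measurable X]setTI; exact: measurable_coord_cV.
by apply/seteqP; split => x /= Bx i => [_|]; exact: Bx.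
Qed.

(** Boxes, unlike one-coordinate cylinders, are closed under intersection, as the uniqueness theorem
    for measures demands. A cylinder is a box whose other sides are full. *)
Lemma measurable_cVE n : @measurable _ 'cV[R]_n =
  <<s [set B | exists A : 'I_n -> set R, (forall i, measurable (A i)) /\ B = cbox A] >>.
Proof.
apply/seteqP; split; last first.
  apply: smallest_sub; first exact: sigma_algebra_measurable.
  by move=> _ [A [mA ->]]; exact: measurable_cbox.
suff: <<s \big[setU/set0]_(i < n)
   preimage_set_system setT (fun x : 'cV[R]_n => x i ord0) measurable >>
   `<=` <<s [set B | exists A : 'I_n -> set R, (forall i, measurable (A i)) /\ B = cbox A] >>.
  by apply.
apply: smallest_sub; first exact: smallest_sigma_algebra.
rewrite -bigcup_seq/= => B [i _ [C mC <-]] /=; rewrite setTI.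
apply: sub_sigma_algebra; exists (fun j => if j == i then C else setT); split.
  by move=> j; case: ifP.
apply/seteqP; split => [x /= Cx j|x /(_ i)]; last by rewrite eqxx.
by case: eqP => [->|].
Qed.

Lemma lebesgue_cV_unique n (nu : {measure set 'cV[R]_n -> \bar R}) :
  (forall A : 'I_n -> set R, (forall i, measurable (A i)) ->
    nu (cbox A) = (\prod_(i < n) lebesgue_measure (A i))%E) ->
  forall X, measurable X -> lebesgue_cV n X = nu X.
Proof.
move=> nuE X mX.
pose g (k : nat) := cbox (fun=> `[- k%:R, k%:R]%classic) : set 'cV[R]_n.
apply: (measure_unique _ g (measurable_cVE n)) => //.
- move=> _ _ [A [mA ->]] [B [mB ->]]; exists (fun i => A i `&` B i); split.
    by move=> i; exact: measurableI.
  by apply/seteqP; split => [x [Ax Bx] i|x AB]; [split|split=> i; have [] := AB i].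
- by move=> k; exists (fun=> `[- k%:R, k%:R]%classic).
- apply/seteqP; split=> // x _.
  exists (Num.truncn (\sum_i `|x i ord0|)).+1 => // i /=.
  rewrite in_itv/= -ler_norml; apply: (@le_trans _ _ (\sum_i `|x i ord0|)).
    by rewrite (bigD1 i)//= lerDl sumr_ge0.
  exact/ltW/truncnS_gt.
- by move=> _ [A [mA ->]]; rewrite nuE//; exact: lebesgue_cV_box.
- move=> k; apply: (@lebesgue_cV_bounded _ _ _ k%:R).
    exact: measurable_cbox.
  by move=> u uk i; have := uk i; rewrite /= in_itv/= -ler_norml.
Qed.

Lemma lebesgue_measure_translate (c : R) (A : set R) : measurable A ->
  lebesgue_measure ((fun x => x + c) @^-1` A) = lebesgue_measure A.
Proof.
move=> mA.
have mc : measurable_fun [set: measurableTypeR R]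
    ((fun x : R => x + c) : measurableTypeR R -> measurableTypeR R).
  by apply: measurable_funD.
apply/esym.
apply: (@lebesgue_measure_unique R (image_measure lebesgue_measure mc)) => //=.
move=> _ [[a b]] _ <-; rewrite /=.
rewrite [RHS](_ : _ = lebesgue_measure [set` `]a - c, b - c]]).
  rewrite !lebesgue_measure_itv/= !lte_fin ltrD2r; case: ifPn => // _.
  by rewrite -!EFinB; congr EFin; ring.
congr lebesgue_measure; apply/seteqP; split => x /=; rewrite !in_itv/=.
  by rewrite ltrBlDr lerBrDr.
by rewrite ltrBlDr lerBrDr.
Qed.

Lemma lebesgue_cV_translate n (c : 'cV[R]_n) (A : set 'cV[R]_n) : measurable A ->
  lebesgue_cV n ((fun u => u + c) @^-1` A) = lebesgue_cV n A.
Proof.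
move=> mA; apply/esym.
apply: (lebesgue_cV_unique (nu := image_measure (lebesgue_cV n) (measurable_translate_cV c))) => // B mB.
rewrite image_measureE.
rewrite (_ : _ @^-1` _ = cbox (fun i => (fun x => x + c i ord0) @^-1` B i)).
  have mBc i : measurable ((fun x => x + c i ord0) @^-1` B i).
    rewrite -[X in measurable X]setTI.
    by apply: (measurable_funD (@measurable_id _ _ setT) (measurable_cst _)).
  rewrite [LHS](lebesgue_cV_box mBc); apply: eq_bigr => i _.
  exact: lebesgue_measure_translate.
by apply/seteqP; split => x xB i; have := xB i; rewrite /= mxE.
Qed.

End lebesgue_cV_unique.

Section integral_image_measure.
Local Open Scope ereal_scope.
Context d1 d2 (T1 : measurableType d1) (T2 : measurableType d2) (R : realType).
Variables (mu : {measure set T1 -> \bar R}) (f : T1 -> T2).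
Hypothesis mf : measurable_fun [set: T1] f.

Lemma integral_image_measure D (F : T2 -> \bar R) : measurable D ->
  measurable_fun setT F ->
  \int[image_measure mu mf]_(y in D) F y = \int[mu]_(x in f @^-1` D) F (f x).
Proof.
move=> mD mF; rewrite integralE [RHS]integralE; congr (_ - _).
  rewrite [LHS](ge0_integral_pushforward mf mu)//.
    by apply: eq_integral => x _; rewrite -(funepos_comp F f).
  exact/measurable_funepos/measurable_funTS.
rewrite [LHS](ge0_integral_pushforward mf mu)//.
  by apply: eq_integral => x _; rewrite -(funeneg_comp F f).
exact/measurable_funeneg/measurable_funTS.
Qed.

End integral_image_measure.

(** * Modulated and nonvanishing Paley-Wiener functions *)

Section test_functions.
Context {R : realType} (d : nat).
Local Notation mu := (lebesgue_cV d).

Lemma integral_translate (c : 'cV[R]_d) D (F : 'cV[R]_d -> \bar R) : measurable D ->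
  measurable_fun setT F ->
  (\int[mu]_(u in D) F u = \int[mu]_(u in (fun u : 'cV[R]_d => u + c)%R @^-1` D) F (u + c)%R)%E.
Proof.
move=> mD mF; rewrite -(integral_image_measure mu (measurable_translate_cV c))//.
apply: eq_measure_integral => A mA _; apply/esym.
by rewrite image_measureE; exact: lebesgue_cV_translate.
Qed.

(** Modulation by [c] translates the density and its ball by [c]. *)
Lemma PW_modulate (c : 'cV[R]_d) (f : 'cV[R]_d -> R[i]) : PW f ->
  PW (fun x => expi (dotv c x) * f x).
Proof.
move=> [g [c0 [r [gL2 r0 fE]]]].
have mg := L2_cmeasurable gL2.
have mgc : cmeasurable (fun u => g (u - c)).
  case: mg => gR gI; split.
    exact: (measurableT_comp gR (measurable_translate_cV (- c))).
  exact: (measurableT_comp gI (measurable_translate_cV (- c))).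
exists (fun u => g (u - c)), (c0 + c), r; split=> //.
  case: (mgc) => gR gI; split => //.
  have mn : measurable_fun setT (fun u : 'cV[R]_d => ((nc (g (u - c))) ^+ 2)%:E).
    by apply/measurable_EFinP; apply: measurable_funX; exact: cmeasurable_nc mgc.
  rewrite (integral_translate c measurableT mn) preimage_setT.
  under eq_integral do rewrite addrK.
  by case: gL2.
move=> t; rewrite fE -cintegralZ; last 2 first.
- exact: measurable_eball.
- apply: (@cintegrable_dom _ _ _ _ (fun u => 1 + nc (g u) ^+ 2)).
  + exact: measurable_eball.
  + apply: cmeasurableM => //; apply: cmeasurable_expi; exact: measurable_linear_cV.
  + by apply: L2_weight_integrable => //; [exact: measurable_eball|exact: eball_finite].
  + by move=> u _; rewrite ncM nc_expi mulr1 nc_le_weight.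
have mh : cmeasurable (fun u => g (u - c) * expi (dotv u t)).
  by apply: cmeasurableM => //; apply: cmeasurable_expi; exact: measurable_linear_cV.
have mB := measurable_eball (c0 + c) r.
have BE : (fun u : 'cV[R]_d => u + c) @^-1` eball (c0 + c) r = eball c0 r.
  by apply/seteqP; split => u; rewrite /eball/= opprD addrACA subrr addr0.
transitivity (cintegral (eball c0 r) (fun u => g (u + c - c) * expi (dotv (u + c) t))).
  apply: eq_cintegral => u _; rewrite addrK dotvC (dotvC (u + c)) dotvDr addrC expiD.
  by rewrite mulrCA (dotvC t u) (dotvC t c).
rewrite /cintegral /Rintegral.
congr (fine _ +i* fine _); rewrite [RHS](integral_translate c mB) ?BE//;
  by apply/measurable_EFinP; case: mh.
Qed.

Lemma lebesgue_eball_gt0 (r : R) : 0 < r -> (0 < mu (eball 0 r))%E.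
Proof.
(* Half-side of a cube inside the ball: [d * e ^+ 2 < r ^+ 2] because [d < d.+1 ^ 2], in dimension 0
   as well. *)
move=> r0; pose e := r / d.+1%:R.
have e0 : 0 < e by rewrite divr_gt0.
pose A (i : 'I_d) : set R := `[- e, e]%classic.
have mAi i : measurable (A i) by exact: measurable_itv.
have mA : measurable (cbox A) by exact: measurable_cbox.
apply: (@lt_le_trans _ _ (mu (cbox A))).
  rewrite [ltRHS](lebesgue_cV_box mAi).
  rewrite (_ : (\prod_(i < d) _)%E = (\prod_(i < d) (e *+ 2))%:E).
    by rewrite lte_fin prodr_gt0// => i _; rewrite pmulrn_lgt0.
  rewrite -prodEFin; apply: eq_bigr => i _.
  rewrite /A lebesgue_measure_itv/= lte_fin ifT ?gtrN//.
  by rewrite -EFinB opprK mulr2n.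
apply: le_measure; rewrite ?inE//; first exact: measurable_eball.
move=> u uA; rewrite /eball/= subr0 /dotv.
have ue i : u i ord0 * u i ord0 <= e ^+ 2.
  rewrite -expr2 -real_normK ?num_real// lerXn2r ?nnegrE ?(ltW e0)//.
  by have := uA i; rewrite /A/= in_itv/= ler_norml.
apply: (@le_lt_trans _ _ (\sum_(i < d) e ^+ 2)); first exact: ler_sum.
rewrite sumr_const card_ord -mulr_natl.
apply: (@lt_le_trans _ _ (d.+1%:R ^+ 2 * e ^+ 2)).
  rewrite ltr_pM2r ?exprn_gt0// -natrX ltr_nat.
  by rewrite (@leq_trans d.+1)// -mulnn leq_pmull.
by rewrite -exprMn /e mulrC divfK.
Qed.

(** The transform of the indicator of a ball so small that [dotv u x] stays in [-1, 1] for [x] in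
    the cube; the real part of the integrand is then at least 1/2. *)
Lemma PW_nonvanishing (K : R) : exists f : 'cV[R]_d -> R[i], PW f /\
  forall x : 'cV[R]_d, (forall i, `|x i ord0| <= K) -> f x != 0.
Proof.
pose r := (1 + d%:R * `|K|)^-1.
have r0 : 0 < r by rewrite invr_gt0 ltr_pwDl// mulr_ge0.
pose B := eball (0 : 'cV[R]_d) r.
have mB : measurable B by exact: measurable_eball.
have Bfin : (mu B < +oo)%E by exact: eball_finite.
pose g (u : 'cV[R]_d) : R[i] := (\1_B u)%:C.
have mg : cmeasurable g.
  by split => /=; [exact: measurable_indic|exact: measurable_cst].
exists (fun t => cintegral B (fun u => g u * expi (dotv u t))); split.
  exists g, 0, r; split => //; split; [by case: mg|by case: mg|].
  rewrite (_ : (fun u => _) = (EFin \o \1_B)); last first.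
    apply/funext => u; rewrite /g /= expr0n addr0 sqrtr_sqr ger0_norm//.
    by rewrite indicE; case: (u \in B); rewrite ?expr1n ?expr0n.
  by rewrite integral_indic// setIT.
move=> x xK; apply/negP => /eqP/(congr1 (@complex.Re R)) /=; apply/eqP.
rewrite gt_eqF//.
have mh : cmeasurable (fun u => g u * expi (dotv u x)).
  by apply: cmeasurableM => //; apply: cmeasurable_expi; exact: measurable_linear_cV.
have icst (a : R) : mu.-integrable B (EFin \o cst a).
  apply/integrableP; split; first exact/measurable_EFinP.
  under eq_integral do rewrite /=.
  by rewrite integral_cst//= lte_mul_pinfty.
have [hR _] : cintegrable B (fun u => g u * expi (dotv u x)).
  apply: (cintegrable_dom mB mh (icst 1)) => u Bu.
  by rewrite ncM nc_expi mulr1 /g /= indicE mem_set//= expr1n expr0n addr0 sqrtr1.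
apply: (@lt_le_trans _ _ (\int[mu]_(u in B) 2^-1)).
  rewrite Rintegral_cst// mulr_gt0// fine_gt0// Bfin andbT.
  exact: lebesgue_eball_gt0.
apply: (le_Rintegral mB (icst _) hR) => u Bu.
rewrite /g indicE mem_set//= mul0r subr0 mul1r.
have ux : `|dotv u x| <= 1.
  apply: (@le_trans _ _ (\sum_(i < d) r * `|K|)).
    apply: le_trans (ler_norm_sum _ _ _) _; apply: ler_sum => i _.
    rewrite normrM ler_pM//; last exact: le_trans (xK i) (ler_norm _).
    by have := eball_coord i r0 Bu; rewrite mxE subr0 => /ltW.
  rewrite sumr_const card_ord -mulr_natl mulrCA mulrC ler_pdivrMr; last first.
    by rewrite ltr_pwDl// mulr_ge0.
  by rewrite mul1r lerDr.
suff : (2^-1 : R) <= cos (dotv u x) by [].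
have := cos_ge_quadratic (dotv u x); have : dotv u x ^+ 2 <= 1.
  by rewrite -real_normK ?num_real// expr_le1.
lra.
Qed.

End test_functions.

(** * Superposition operators are affine *)

Section superposition_affine.
Context {R : realType}.

(** Cauchy's equation. The additive function [g] vanishes at the integers, so it has period 1 and is
    bounded by its maximum on [0, 1]; a bounded additive function is 0. *)
Lemma additive_continuous_linear (e : R -> R) : {morph e : x y / x + y} ->
  continuous e -> forall s, e s = s * e 1.
Proof.
move=> eD ec; pose g s := e s - s * e 1.
have gD : {morph g : x y / x + y} by move=> x y; rewrite /g eD; ring.
have g0 : g 0 = 0 by apply: (addrI (g 0)); rewrite -gD !addr0.
have gN x : g (- x) = - g x by apply: (addrI (g x)); rewrite -gD !subrr g0.
have gn n x : g (n%:R * x) = n%:R * g x.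
  elim: n => [|n IH]; first by rewrite !mul0r g0.
  by rewrite -natr1 !mulrDl !mul1r gD IH.
have gz z : g z%:~R = 0.
  have gnat n : g n%:R = 0.
    by rewrite -[n%:R]mulr1 gn /g mul1r subrr mulr0.
  by case: z => n; rewrite ?NegzE ?rmorphN ?gN /= ?gnat// oppr0.
have gc : continuous g.
  by move=> x; apply: cvgB; [exact: ec|apply: cvgMl].
have [c _ cmax] : exists2 c, c \in `[0, 1] &
    forall t, t \in `[0, 1] -> `|g t| <= `|g c|.
  apply: (EVT_max (f := fun x => `|g x|)) => //.
  apply: continuous_subspaceT => x.
  by apply: continuous_comp; [exact: gc|exact: norm_continuous].
have gb s : `|g s| <= `|g c|.
  have -> : g s = g (s - (Num.floor s)%:~R) by rewrite gD gN gz oppr0 addr0.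
  apply: cmax; rewrite in_itv/= subr_ge0 floor_le/=.
  by have := floorD1_gt s; rewrite intrD; lra.
move=> s; suff : g s = 0 by rewrite /g => /eqP; rewrite subr_eq0 => /eqP.
apply/eqP; rewrite -normr_eq0 eq_le normr_ge0 andbT leNgt; apply/negP => gs.
have := gb ((Num.truncn (`|g c| / `|g s|)).+1%:R * s).
rewrite gn normrM normr_nat leNgt -ltr_pdivrMr// => /negP; apply.
exact: truncnS_gt.
Qed.

Variables (m n : nat) (phi : 'cV[R]_m -> 'cV[R]_n).
Hypothesis phi_cont : continuous phi.

Lemma continuous_line (t v : 'cV[R]_m) j :
  continuous (fun s : R => phi (t + s *: v) j ord0).
Proof.
move=> s; apply: (@continuous_comp _ _ _ (fun s : R => t + s *: v)
  (fun x => phi x j ord0)).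
  by apply: cvgD; [exact: cvg_cst|exact: scalel_continuous].
apply: (@continuous_comp _ _ _ phi (fun y : 'cV[R]_n => y j ord0)).
  exact: phi_cont.
exact: coord_continuous.
Qed.

(** Jensen's equation: [phi a + phi b] depends on [a + b] only, and comparing [(a, b)] with
    [(a + b, 0)] makes [chi] additive. Continuity on lines makes it homogeneous. *)
Lemma midpoint_affine_map :
  (forall t v, phi (t + v) + phi (t - v) = phi t + phi t) -> affine_map phi.
Proof.
move=> mid; pose chi t := phi t - phi 0.
have half (a : 'cV[R]_m) : 2^-1 *: a + 2^-1 *: a = a.
  by rewrite -scalerDl (_ : 2^-1 + 2^-1 = 1 :> R) ?scale1r//; field.
have midE a b : phi a + phi b = phi (2^-1 *: (a + b)) + phi (2^-1 *: (a + b)).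
  rewrite -(mid _ (2^-1 *: (a - b))) !scalerDr !scalerN; congr (phi _ + phi _).
    by rewrite addrACA addrN addr0 half.
  by rewrite opprD opprK addrACA addrN add0r half.
have chiD : {morph chi : a b / a + b}.
  move=> a b; rewrite /chi; have := midE (a + b) 0.
  by rewrite addr0 -midE => /(congr1 (fun z => z - phi 0 - phi 0));
    rewrite addrK => ->; rewrite [RHS]addrACA addrA.
have chiZ s v : chi (s *: v) = s *: chi v.
  apply/colP => j; rewrite [RHS]mxE.
  pose e (s : R) := chi (s *: v) j ord0.
  have eD : {morph e : x y / x + y} by move=> x y; rewrite /e scalerDl chiD mxE.
  have ec : continuous e.
    rewrite (_ : e = fun s => phi (0 + s *: v) j ord0 - phi 0 j ord0); last first.
      by apply/funext => x; rewrite /e /chi !mxE add0r.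
    by move=> x; apply: cvgB; [exact: continuous_line|exact: cvg_cst].
  by have := additive_continuous_linear eD ec s; rewrite /e scale1r.
exists (\matrix_(i, j) chi (delta_mx j ord0) i ord0), (phi 0) => t.
apply/eqP; rewrite -subr_eq -/(chi t); apply/eqP.
have chi0 : chi 0 = 0 by rewrite /chi subrr.
have -> : chi t = \sum_j t j ord0 *: chi (delta_mx j ord0).
  rewrite {1}[t]matrix_sum_delta exchange_big big_ord1 (big_morph chi chiD chi0).
  by apply: eq_bigr => j _; rewrite chiZ.
apply/colP => i; rewrite summxE [RHS]mxE; apply: eq_bigr => j _.
by rewrite !mxE mulrC.
Qed.

Hypothesis phiPW : forall f : 'cV[R]_n -> R[i], PW f -> PW (f \o phi).

Lemma PW_superposition_affine : affine_map phi.
Proof.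
apply: midpoint_affine_map => t v; apply/colP => j; rewrite !mxE.
(* Bounds the coordinates of the three points at which [f] has to be nonzero. *)
pose K := \sum_i (`|phi t i ord0| + `|phi (t + v) i ord0| + `|phi (t - v) i ord0|).
have [f [fPW fn0]] := PW_nonvanishing n K.
have Kge (x : 'cV[R]_n) : (forall i, `|x i ord0| <=
    `|phi t i ord0| + `|phi (t + v) i ord0| + `|phi (t - v) i ord0|) -> f x != 0.
  move=> xK; apply: fn0 => i; apply: le_trans (xK i) _.
  rewrite /K (bigD1 i)//= lerDl; apply: sumr_ge0 => k _.
  by rewrite !addr_ge0.
have := @midpoint_affine R (fun s => phi (t + s *: v) j ord0)
  (fun s => f (phi (t + s *: v))) (@continuous_line t v j).
rewrite scale0r addr0 scale1r scaleN1r mulr2n mulrDl mul1r; apply.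
(* Modulating [f] by [r] times the [j]-th basis vector produces the factor [expi (r * psi s)] after
   composition with [phi]. *)
- move=> r; pose c : 'cV[R]_n := r *: delta_mx j ord0.
  have [M [N [N0 MN]]] := PW_line_bandlim t v (phiPW (PW_modulate c fPW)).
  exists M, N; split => //; move: MN; congr bandlim.
  apply/funext => s /=; congr (expi _ * _).
  rewrite dotvC dotvZr /dotv (bigD1 j)//= big1 ?addr0 ?mxE ?eqxx ?mulr1// => i ij.
  by rewrite mxE (negbTE ij) mulr0.
- by apply: Kge => i; rewrite -addrA lerDl addr_ge0.
- by apply: Kge => i; rewrite addrAC lerDr addr_ge0.
- by apply: Kge => i; rewrite lerDr addr_ge0.
Qed.

End superposition_affine.

(** * Linear changes of variables *)

Section haar.
Context {R : realType} (N : nat).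
Local Notation mu := (lebesgue_cV N).
Local Notation V := 'cV[R]_N.

Lemma measurable_add_cV d (T : measurableType d) (f g : T -> V) :
  measurable_fun setT f -> measurable_fun setT g ->
  measurable_fun setT (fun x => f x + g x).
Proof.
move=> mf mg; apply: measurable_fun_cVP => i.
under eq_fun do rewrite mxE.
apply: measurable_funD.
  exact: (measurableT_comp (measurable_coord_cV i) mf).
exact: (measurableT_comp (measurable_coord_cV i) mg).
Qed.

Lemma measurable_opp_cV d (T : measurableType d) (f : T -> V) :
  measurable_fun setT f -> measurable_fun setT (fun x => - f x).
Proof.
move=> mf; apply: measurable_fun_cVP => i.
under eq_fun do rewrite mxE.
apply: measurable_funN.
exact: (measurableT_comp (measurable_coord_cV i) mf).
Qed.

Lemma integral_sections d1 d2 (T1 : measurableType d1) (T2 : measurableType d2)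
    (m1 : {sigma_finite_measure set T1 -> \bar R})
    (m2 : {sigma_finite_measure set T2 -> \bar R}) (A : set (T1 * T2)) :
  measurable A ->
  (\int[m1]_x m2 (xsection A x) = \int[m2]_y m1 (ysection A y))%E.
Proof.
move=> mA; have := @indic_fubini_tonelli _ _ _ _ _ m1 m2 A mA.
by rewrite indic_fubini_tonelli_FE// indic_fubini_tonelli_GE.
Qed.

Variable nu : {sigma_finite_measure set V -> \bar R}.
Hypothesis nu_translate : forall (c : V) A, measurable A ->
  nu ((fun u => u + c) @^-1` A) = nu A.

(** A test set of Lebesgue measure 1, so that the constant of proportionality is [nu] of its
    reflection [Q']. *)
Let Q : set V := cbox (fun=> `[0, 1]%classic).

Let mQ : measurable Q.
Proof. by apply: measurable_cbox => i; exact: measurable_itv. Qed.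

Let muQ : mu Q = 1%E.
Proof.
rewrite (lebesgue_cV_box (A := fun=> `[0, 1]%classic))//.
by rewrite big1// => i _; rewrite lebesgue_measure_itv/= lte01 oppr0 adde0.
Qed.

Let Q' : set V := (fun u => - u) @^-1` Q.

Let mfst : measurable_fun [set: V * V] (fun p : V * V => p.1).
Proof. exact: measurable_fst. Qed.
Let msnd : measurable_fun [set: V * V] (fun p : V * V => p.2).
Proof. exact: measurable_snd. Qed.

(* [nu A * mu Q] is the [nu \x mu]-measure of [{(x, y) | y \in Q, x + y \in A}];
   the shear [y := z - x] turns it into [{(x, z) | z \in A, z - x \in Q}], all of
   whose sections over [z] are translates of [- Q]. *)
Lemma translation_invariant_unique A : measurable A -> nu A = (nu Q' * mu A)%E.
Proof.
move=> mA.
pose Z1 : set (V * V) := (fun p => p.2) @^-1` Q `&` (fun p => p.1 + p.2) @^-1` A.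
pose Z2 : set (V * V) := (fun p => p.2) @^-1` A `&` (fun p => p.2 - p.1) @^-1` Q.
have mZ1 : measurable Z1.
  apply: measurableI; first exact: measurable_preimage.
  by apply: measurable_preimage => //; exact: measurable_add_cV.
have mZ2 : measurable Z2.
  apply: measurableI; first exact: measurable_preimage.
  apply: measurable_preimage => //; apply: measurable_add_cV => //.
  exact: measurable_opp_cV.
have mAy y : measurable ((fun u : V => u + y) @^-1` A).
  by apply: measurable_preimage => //; exact: measurable_translate_cV.
transitivity (\int[mu]_y nu (ysection Z1 y))%E.
  transitivity (\int[mu]_(y in Q) cst (nu A) y)%E.
    by rewrite integral_cst// -[LHS]mule1; congr (_ * _)%E; exact/esym/muQ.
  rewrite integral_mkcond; apply: eq_integral => y _; rewrite patchE.
  case: ifPn => yQ.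
    rewrite /= -(nu_translate y mA); congr (nu _); apply/seteqP.
    by split => x; rewrite /ysection/= inE /Z1/=; [split=> //; exact/set_mem|case].
  rewrite (_ : ysection _ _ = set0) ?measure0//; apply/seteqP; split => // x.
  by rewrite /ysection/= inE => -[/= Qy _]; rewrite mem_set in yQ.
rewrite -integral_sections//.
transitivity (\int[nu]_x mu (xsection Z2 x))%E.
  apply: eq_integral => x _.
  (* For fixed [x] the shear is the translation by [x]. *)
  rewrite -(lebesgue_cV_translate x (A := xsection Z2 x)); last exact: measurable_xsection.
  congr (mu _); apply/seteqP; split => y; rewrite /xsection/= !inE /Z1 /Z2/= addrK addrC.
    by case.
  by case.
rewrite integral_sections//.
have mQ' : measurable Q'.
  by apply: measurable_preimage => //; exact: measurable_opp_cV.
transitivity (\int[mu]_(y in A) cst (nu Q') y)%E; last by rewrite integral_cst.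
rewrite [RHS]integral_mkcond; apply: eq_integral => z _; rewrite patchE.
case: ifPn => zA.
  have mz : measurable (ysection Z2 z) by exact: measurable_ysection.
  rewrite -(nu_translate z mz); congr (nu _); apply/seteqP.
  split => x; rewrite /ysection/= inE /Z2/= opprD addrCA subrr addr0.
    by case.
  by move=> Qx; split=> //; exact/set_mem.
rewrite (_ : ysection _ _ = set0) ?measure0//; apply/seteqP; split => // x.
by rewrite /ysection/= inE => -[/= Az _]; rewrite mem_set in zA.
Qed.

End haar.

Section product_decomposition.
Context {R : realType} (m k : nat).

Definition glue (p : 'cV[R]_m * 'cV[R]_k) : 'cV[R]_(m + k) := col_mx p.1 p.2.

Lemma measurable_glue : measurable_fun setT glue.
Proof.
apply: measurable_fun_cVP => i; rewrite /glue.
rewrite -(splitK i); case: (fintype.split i) => j /=.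
  under eq_fun do rewrite col_mxEu.
  exact: (measurableT_comp (measurable_coord_cV j) measurable_fst).
under eq_fun do rewrite col_mxEd.
exact: (measurableT_comp (measurable_coord_cV j) measurable_snd).
Qed.

(** By uniqueness it suffices to compare the two measures on boxes, which split into a product. *)
Lemma lebesgue_cV_glue A : measurable A ->
  lebesgue_cV (m + k) A = (lebesgue_cV m \x lebesgue_cV k)%E (glue @^-1` A).
Proof.
move=> mA.
apply: (lebesgue_cV_unique
  (nu := image_measure (lebesgue_cV m \x lebesgue_cV k)%E measurable_glue)) => // B mB.
rewrite image_measureE (_ : glue @^-1` cbox B =
    cbox (fun i => B (lshift k i)) `*` cbox (fun i => B (rshift m i))).
  have mBl : measurable (cbox (fun i => B (lshift k i))) by exact: measurable_cbox.
  have mBr : measurable (cbox (fun i => B (rshift m i))) by exact: measurable_cbox.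
  transitivity (lebesgue_cV m (cbox (fun i => B (lshift k i))) *
      lebesgue_cV k (cbox (fun i => B (rshift m i))))%E.
    exact: product_measure1E.
  by rewrite big_split_ord; congr (_ * _)%E; exact: lebesgue_cV_box.
apply/seteqP; split => [[y w] /= yw|[y w] /= [By Bw] i].
  by split=> i; [have := yw (lshift k i); rewrite /glue col_mxEu|
    have := yw (rshift m i); rewrite /glue col_mxEd].
rewrite /glue mxE; case: splitP => j ij.
  by have := By j; congr (B _ _); exact: val_inj.
by have := Bw j; congr (B _ _); exact: val_inj.
Qed.

End product_decomposition.

Section linear_change.
Context {R : realType}.

Lemma lebesgue_cVT_gt0 n : (0 < lebesgue_cV n (setT : set 'cV[R]_n))%E.
Proof.
apply: (@lt_le_trans _ _ (lebesgue_cV n (eball 0 1))); first exact: lebesgue_eball_gt0.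
by apply: le_measure; rewrite ?inE//; exact: measurable_eball.
Qed.

(** Adding [c] after [X] is adding [P *m c] before it, so the image measure is translation
    invariant. The dimensions [n] and [N] agree but stay distinct in the types, since [N] will be of
    the form [m + k]. *)
Lemma lebesgue_cV_linear n N (X : 'M[R]_(N, n)) (P : 'M[R]_(n, N)) :
  X *m P = 1%:M -> P *m X = 1%:M ->
  exists2 c : R, 0 < c & forall A, measurable A ->
    lebesgue_cV n ((fun u => X *m u) @^-1` A) = (c%:E * lebesgue_cV N A)%E.
Proof.
move=> XP PX.
pose nu0 := image_measure (lebesgue_cV n) (measurable_mulmx_cV X).
(* Preimages of bounded sets under [X] are bounded, which makes the image measure finite on
   balls. *)
have Pbnd (u : 'cV[R]_n) (K : R) : (forall j, `|(X *m u) j ord0| <= K) ->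
    forall i, `|u i ord0| <= \sum_i \sum_j `|P i j| * `|K|.
  move=> XuK i; rewrite -[u]mul1mx -PX -mulmxA mxE.
  apply: (@le_trans _ _ (\sum_j `|P i j| * `|K|)).
    apply: le_trans (ler_norm_sum _ _ _) _; apply: ler_sum => j _.
    by rewrite normrM ler_wpM2l// (le_trans (XuK j))// ler_norm.
  rewrite [leRHS](bigD1 i)//= lerDl; apply: sumr_ge0 => l _.
  by apply: sumr_ge0 => j _; rewrite mulr_ge0.
have nu0_fin (K : R) (A : set 'cV[R]_N) : measurable A ->
    (forall x, A x -> forall j, `|x j ord0| <= K) -> (nu0 A < +oo)%E.
  move=> mA AK; apply: (@lebesgue_cV_bounded _ _ _ (\sum_i \sum_j `|P i j| * `|K|)).
    by apply: measurable_preimage => //; exact: measurable_mulmx_cV.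
  by move=> u Au; apply: Pbnd => j; exact: AK.
have nu0_sf : sigma_finite setT nu0.
  exists (fun k => eball 0 k.+1%:R).
    apply/esym/seteqP; split=> // x _.
    exists (Num.truncn (dotv x x)).+1 => //=; rewrite /eball/= subr0.
    have xlt := truncnS_gt (dotv x x).
    set q := (Num.truncn _).+1 in xlt *.
    apply: (lt_trans xlt); rewrite -natrX ltr_nat -mulnn.
    by rewrite leq_pmulr.
  move=> k; have mk : measurable (eball (0 : 'cV[R]_N) k.+1%:R) by exact: measurable_eball.
  split => //.
  have [K cK] := @eball_bounded R N 0 k.+1%:R (ltr0Sn _ _).
  exact: nu0_fin cK.
pose nu : {sigma_finite_measure set 'cV[R]_N -> \bar R} :=
  HB.pack (nu0 : set 'cV[R]_N -> \bar R) (Measure.class nu0)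
    (Measure_isSigmaFinite.Build _ _ _ nu0 nu0_sf).
have nu_tr (c : 'cV[R]_N) A : measurable A -> nu ((fun u => u + c) @^-1` A) = nu A.
  move=> mA.
  change (lebesgue_cV n ((fun u : 'cV[R]_n => X *m u) @^-1` ((fun u => u + c) @^-1` A)) =
    lebesgue_cV n ((fun u : 'cV[R]_n => X *m u) @^-1` A)).
  have mXA : measurable ((fun u => X *m u) @^-1` A).
    by apply: measurable_preimage => //; exact: measurable_mulmx_cV.
  rewrite -(lebesgue_cV_translate (P *m c) mXA); congr (lebesgue_cV n _).
  by apply/seteqP; split => u /=; rewrite mulmxDr mulmxA XP mul1mx.
have := translation_invariant_unique nu_tr.
set Q' := (X in nu X); move=> nuE.
have Qfin : (nu0 Q' < +oo)%E.
  apply: (nu0_fin 1); rewrite /Q'.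
    apply: measurable_preimage; first exact: (@measurable_opp_cV _ _ _ _ id).
    by apply: measurable_cbox => i; exact: measurable_itv.
  move=> x xQ j; have := xQ j; rewrite /= in_itv/= mxE => /andP[x0 x1].
  by rewrite ler_norml; lra.
have Q0 : (0 <= nu0 Q')%E by exact: measure_ge0.
have QE : nu0 Q' = (fine (nu0 Q'))%:E by rewrite fineK// ge0_fin_numE.
have nu0E A : measurable A -> nu0 A = ((fine (nu0 Q'))%:E * lebesgue_cV N A)%E.
  by move=> mA; rewrite -QE; exact: nuE.
exists (fine (nu0 Q')); last by move=> A mA; rewrite -nu0E.
(* A constant 0 would make the whole space a null set. *)
rewrite lt_def fine_ge0// andbT; apply/negP => /eqP c0.
have := nu0E _ measurableT; rewrite c0 mul0e image_measureE preimage_setT => T0.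
by have := lebesgue_cVT_gt0 n; rewrite T0 ltxx.
Qed.

Variables (m k n : nat) (P : 'M[R]_(n, m + k)) (c : R).
Variable X : 'M[R]_(m + k, n).
Hypothesis c_gt0 : 0 < c.
Hypothesis PX : P *m X = 1%:M.
Hypothesis muX : forall A, measurable A ->
  lebesgue_cV n ((fun u => X *m u) @^-1` A) = (c%:E * lebesgue_cV (m + k) A)%E.

Local Notation prodmu := (lebesgue_cV m \x lebesgue_cV k)%E.

Lemma ge0_integral_linear_change (F : 'cV[R]_n -> \bar R) : measurable_fun setT F ->
  (forall u, 0 <= F u)%E ->
  (\int[lebesgue_cV n]_u F u = c%:E * \int[prodmu]_p F (P *m glue p))%E.
Proof.
move=> mF F0.
have mFP : measurable_fun setT (fun x : 'cV[R]_(m + k) => F (P *m x)).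
  exact: (measurableT_comp mF (measurable_mulmx_cV P)).
transitivity (\int[lebesgue_cV n]_(u in (fun u => X *m u) @^-1` setT) F (P *m (X *m u)))%E.
  by rewrite preimage_setT; apply: eq_integral => u _; rewrite mulmxA PX mul1mx.
rewrite -(integral_image_measure (lebesgue_cV n) (measurable_mulmx_cV X) measurableT mFP).
pose c' : {nonneg R} := NngNum (ltW c_gt0).
transitivity (\int[mscale c' (lebesgue_cV (m + k))]_u F (P *m u))%E.
  by apply: eq_measure_integral => A mA _; exact: muX.
rewrite ge0_integral_mscale//; congr (_ * _)%E.
transitivity (\int[image_measure prodmu (@measurable_glue R m k)]_u F (P *m u))%E.
  by apply: eq_measure_integral => A mA _; exact: lebesgue_cV_glue.
by rewrite integral_image_measure// preimage_setT.
Qed.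

Lemma Rintegral_linear_change (F : 'cV[R]_n -> R) :
  (lebesgue_cV n).-integrable setT (EFin \o F) ->
  prodmu.-integrable setT (EFin \o (fun p => F (P *m glue p))) /\
  \int[lebesgue_cV n]_u F u = c * \int[prodmu]_p F (P *m glue p).
Proof.
move=> iF; have mF := measurable_int _ iF.
have mP : measurable_fun setT (fun p : 'cV[R]_m * 'cV[R]_k => P *m glue p).
  exact: (measurableT_comp (measurable_mulmx_cV P) (@measurable_glue R m k)).
have iFP : prodmu.-integrable setT (EFin \o (fun p => F (P *m glue p))).
  apply/integrableP; split; first exact: (measurableT_comp mF mP).
  move/integrableP : iF => [_].
  rewrite (ge0_integral_linear_change (F := fun u => `|(F u)%:E|%E))//; last first.
    exact: measurableT_comp.
  set I := integral _ _ _; have I0 : (0 <= I)%E by exact: integral_ge0.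
  have [-> |Ifin _] := eqVneq I +oo%E; first by rewrite gt0_muley// lte_fin.
  by rewrite ltey.
split => //.
have E1 : (\int[lebesgue_cV n]_u (EFin \o F)^\+ u =
    c%:E * \int[prodmu]_p (EFin \o (fun p => F (P *m glue p)))^\+ p)%E.
  rewrite (ge0_integral_linear_change (F := (EFin \o F)^\+%E))//.
    congr (_ * _)%E; apply: eq_integral => p _.
    exact: (esym (congr1 (@^~ p) (funepos_comp (EFin \o F) (fun p => P *m glue p)))).
  exact: measurable_funepos.
have E2 : (\int[lebesgue_cV n]_u (EFin \o F)^\- u =
    c%:E * \int[prodmu]_p (EFin \o (fun p => F (P *m glue p)))^\- p)%E.
  rewrite (ge0_integral_linear_change (F := (EFin \o F)^\-%E))//.
    congr (_ * _)%E; apply: eq_integral => p _.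
    exact: (esym (congr1 (@^~ p) (funeneg_comp (EFin \o F) (fun p => P *m glue p)))).
  exact: measurable_funeneg.
rewrite /Rintegral integralE E1 E2 -muleBr//; last first.
  by rewrite fin_num_adde_defr//; exact: integrable_pos_fin_num.
by rewrite -integralE fineM//; exact: integrable_fin_num iFP.
Qed.

End linear_change.

(** * Cauchy-Schwarz on sets of finite measure *)

Section square_integrable.
Context d (T : measurableType d) (R : realType) (mu : {measure set T -> \bar R}).

Lemma integrable_indic_finite (W : set T) : measurable W -> (mu W < +oo)%E ->
  mu.-integrable setT (EFin \o (\1_W : T -> R)).
Proof.
move=> mW Wfin; apply/integrableP; split; first exact/measurable_EFinP.
under eq_integral do rewrite /= ger0_norm//.
by rewrite integral_indic// setIT.
Qed.

Lemma L2_supported_integrable (W : set T) (f : T -> R) :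
  measurable W -> (mu W < +oo)%E -> measurable_fun setT f ->
  (forall x, ~ W x -> f x = 0) ->
  mu.-integrable setT (EFin \o (fun x => f x ^+ 2)) ->
  mu.-integrable setT (EFin \o f).
Proof.
move=> mW Wfin mf f0 if2.
have iw := integrableD measurableT (integrable_indic_finite mW Wfin) if2.
apply: le_integrable iw => //; first exact/measurable_EFinP.
move=> x _; rewrite /= lee_fin; apply: le_trans _ (ler_norm _).
rewrite indicE; have [/set_mem Wx|/negP nWx] := boolP (x \in W).
  rewrite -(real_normK (num_real (f x))).
  rewrite (_ : true%:R = 1 :> R)//.
  by have := sqr_ge0 (`|f x| - 1); have := normr_ge0 (f x); rewrite sqrrB1 mulr2n; lra.
by rewrite f0 ?normr0 ?expr0n/= ?mulr0n ?addr0// => Wx; apply: nWx; exact: mem_set.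
Qed.

(** Cauchy-Schwarz against the indicator of [W]. The bound [V] may exceed the measure of [W], so
    that it can be positive when [W] is a null set. *)
Lemma sqr_Rintegral_le (W : set T) (f : T -> R) (V : R) :
  measurable W -> (mu W < +oo)%E -> 0 < V -> fine (mu W) <= V ->
  measurable_fun setT f -> (forall x, ~ W x -> f x = 0) ->
  mu.-integrable setT (EFin \o (fun x => f x ^+ 2)) ->
  (\int[mu]_x f x) ^+ 2 <= V * \int[mu]_x (f x ^+ 2).
Proof.
move=> mW Wfin V0 WV mf f0 if2.
have if1 := L2_supported_integrable mW Wfin mf f0 if2.
have iabs : mu.-integrable setT (EFin \o (fun x => `|f x|)).
  exact: (integrable_abse if1).
pose a := \int[mu]_x `|f x|; pose b := \int[mu]_x (f x ^+ 2).
have a0 : 0 <= a by apply: Rintegral_ge0 => x _.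
have b0 : 0 <= b by apply: Rintegral_ge0 => x _; exact: sqr_ge0.
apply: (@le_trans _ _ (a ^+ 2)).
  rewrite -(real_normK (num_real (\int[mu]_x f x))) lerXn2r ?nnegrE//.
  exact: le_normr_Rintegral.
rewrite -/b; move: a0; rewrite le_eqVlt => /predU1P[<-|a0].
  by rewrite expr0n/= mulr_ge0// ltW.
(* AM-GM: [2 |f| <= t + f^2 / t] on [W], with [t = a / V] *)
pose t := a / V; have t0 : 0 < t by rewrite divr_gt0.
have i1 : mu.-integrable setT (EFin \o (fun x => (t / 2) * \1_W x)).
  by move: (integrableZl measurableT (t / 2) (integrable_indic_finite mW Wfin));
    apply: eq_integrable.
have i2 : mu.-integrable setT (EFin \o (fun x => (2 * t)^-1 * f x ^+ 2)).
  by move: (integrableZl measurableT (2 * t)^-1 if2); apply: eq_integrable.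
have : a <= \int[mu]_x ((t / 2) * \1_W x + (2 * t)^-1 * f x ^+ 2).
  apply: le_Rintegral => //; first exact: (integrableD measurableT i1 i2).
  move=> x _; rewrite indicE; have [/set_mem Wx|/negP nWx] := boolP (x \in W).
    rewrite -(real_normK (num_real (f x))) (_ : true%:R = 1 :> R)// mulr1.
    have := sqr_ge0 (`|f x| - t); rewrite sqrrB => h.
    have -> : t / 2 + (2 * t)^-1 * `|f x| ^+ 2 =
      `|f x| + (2 * t)^-1 * (`|f x| ^+ 2 - `|f x| * t *+ 2 + t ^+ 2).
      by rewrite -mulr_natr; field; rewrite gt_eqF.
    by rewrite lerDl mulr_ge0// invr_ge0 mulr_ge0// ltW.
  by rewrite f0 ?normr0 ?expr0n/= ?mulr0n ?mulr0 ?addr0// => Wx; apply: nWx; exact: mem_set.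
rewrite RintegralD// !RintegralZl//; last exact: integrable_indic_finite.
rewrite {1}/Rintegral integral_indic// setIT -/b => h.
have : a <= (t / 2) * V + (2 * t)^-1 * b.
  by apply: le_trans h _; rewrite lerD2r ler_wpM2l// divr_ge0// ltW.
have -> : t / 2 * V = a / 2 by rewrite /t; field; rewrite gt_eqF.
have -> : (2 * t)^-1 * b = V * b / a / 2 by rewrite /t; field; rewrite !gt_eqF.
move=> h2; have : a <= V * b / a by lra.
by rewrite ler_pdivlMr// expr2.
Qed.

End square_integrable.

(** * Densities of push-forwards under linear surjections *)

Section marginal.
Context {R : realType}.
Variables (m k n : nat) (T : 'M[R]_(m, n)) (tau : 'M[R]_(k, n)).
Variables (P : 'M[R]_(n, m + k)) (c : R).
Local Notation X := (col_mx T tau).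
Hypothesis c_gt0 : 0 < c.
Hypothesis XP : X *m P = 1%:M.
Hypothesis PX : P *m X = 1%:M.
Hypothesis muX : forall A, measurable A ->
  lebesgue_cV n ((fun u => X *m u) @^-1` A) = (c%:E * lebesgue_cV (m + k) A)%E.

Local Notation prodmu := (lebesgue_cV m \x lebesgue_cV k)%E.

Let TP (p : 'cV[R]_m * 'cV[R]_k) : T *m (P *m glue p) = p.1.
Proof.
have : X *m (P *m glue p) = glue p by rewrite mulmxA XP mul1mx.
by rewrite mul_col_mx /glue => /eq_col_mx[].
Qed.

(* The density of the push-forward of [p du] by [T] is, up to the Jacobian [c],
   the integral of [p] over the fibres of [T]; it is square integrable by
   Cauchy-Schwarz, since the fibres of a bounded set have bounded measure. *)
Lemma pushforward_density (p : 'cV[R]_n -> R) (c0 : 'cV[R]_n) (r : R) : 0 < r ->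
  measurable_fun setT p -> (forall u, ~ eball c0 r u -> p u = 0) ->
  (lebesgue_cV n).-integrable setT (EFin \o (fun u => p u ^+ 2)) ->
  exists (G : 'cV[R]_m -> R) (rho : R), [/\ 0 < rho, measurable_fun setT G,
    (forall y, ~ eball 0 rho y -> G y = 0),
    (lebesgue_cV m).-integrable setT (EFin \o (fun y => G y ^+ 2)) &
    forall b : 'cV[R]_m -> R, measurable_fun setT b -> (forall y, `|b y| <= 1) ->
      \int[lebesgue_cV n]_u (p u * b (T *m u)) = \int[lebesgue_cV m]_y (G y * b y)].
Proof.
move=> r0 mp p0 ip2.
have mB := measurable_eball c0 r; have Bfin := eball_finite c0 r0.
have ip := L2_supported_integrable mB Bfin mp p0 ip2.
pose q z := p (P *m glue z).
have [K0 c0K0] := eball_bounded c0 r0.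
(* [X] maps the ball into the cube of half-side [K], which therefore contains the support of [q] in
   the coordinates (y, w). *)
pose K := \sum_i \sum_j `|X i j| * `|K0|.
have qsupp z : q z != 0 -> forall i, `|glue z i ord0| <= K.
  move=> qz i; have Bz : eball c0 r (P *m glue z).
    by apply: contrapT => /p0 pz; rewrite /q pz eqxx in qz.
  have -> : glue z = X *m (P *m glue z) by rewrite mulmxA XP mul1mx.
  rewrite mxE; apply: (@le_trans _ _ (\sum_j `|X i j| * `|K0|)).
    apply: le_trans (ler_norm_sum _ _ _) _; apply: ler_sum => j _.
    by rewrite normrM ler_wpM2l// (le_trans (c0K0 _ Bz j))// ler_norm.
  rewrite /K (bigD1 i)//= lerDl; apply: sumr_ge0 => l _.
  by apply: sumr_ge0 => j _; rewrite mulr_ge0.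
have qsupp1 y w : q (y, w) != 0 -> forall i, `|y i ord0| <= K.
  by move=> /qsupp qK i; have := qK (lshift k i); rewrite /glue col_mxEu.
have qsupp2 y w : q (y, w) != 0 -> forall i, `|w i ord0| <= K.
  by move=> /qsupp qK i; have := qK (rshift m i); rewrite /glue col_mxEd.
pose W : set 'cV[R]_k := cbox (fun=> `[- K, K]%classic).
have mW : measurable W by apply: measurable_cbox => i; exact: measurable_itv.
have WK w : W w -> forall i, `|w i ord0| <= K.
  by move=> Ww i; have := Ww i; rewrite /= in_itv/= ler_norml.
have KW (w : 'cV[R]_k) : (forall i, `|w i ord0| <= K) -> W w.
  by move=> wK i; rewrite /= in_itv/= -ler_norml; exact: wK.
have Wfin : (lebesgue_cV k W < +oo)%E by exact: lebesgue_cV_bounded WK.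
have [rho rho0 rhoK] := @bounded_sub_eball R m [set y : 'cV[R]_m | forall i, `|y i ord0| <= K] K
  (fun u uK => uK).
have q_out y : ~ eball 0 rho y -> forall w, q (y, w) = 0.
  move=> yrho w; apply: contrapT => /eqP qyw; apply: yrho; apply: rhoK.
  exact: qsupp1 qyw.
have q_outW y w : ~ W w -> q (y, w) = 0.
  by move=> nW; apply: contrapT => /eqP qyw; apply: nW; apply: KW; exact: qsupp2 qyw.
have [iq _] := Rintegral_linear_change c_gt0 PX muX ip.
have [iq2 _] := Rintegral_linear_change c_gt0 PX muX ip2.
have mq : measurable_fun setT q by apply/measurable_EFinP; exact: measurable_int iq.
have mqy y : measurable_fun setT (fun w => q (y, w)).
  exact: measurableT_comp mq (measurable_pair1 y).
(* On a fibre where [q] is not integrable this is a default value. Such fibres form a null set, and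
   there the bound [GL2] is trivial, its right-hand side being infinite. *)
pose G y := c * \int[lebesgue_cV k]_w q (y, w).
have mG : measurable_fun setT G.
  apply: measurable_funM => //.
  apply: measurableT_comp; first exact: fine_measurable.
  exact: measurable_fubini_F iq.
pose V := 1 + fine (lebesgue_cV k W).
have fW0 : 0 <= fine (lebesgue_cV k W) by rewrite fine_ge0.
have V0 : 0 < V by rewrite ltr_pwDl.
have GL2 y : ((G y ^+ 2)%:E <=
    (c ^+ 2 * V)%:E * \int[lebesgue_cV k]_w (q (y, w) ^+ 2)%:E)%E.
  set I := integral _ _ _.
  have I0 : (0 <= I)%E by apply: integral_ge0 => w _; rewrite lee_fin sqr_ge0.
  have [Ioo|Ifin] := eqVneq I +oo%E.
    by rewrite Ioo gt0_muley ?leey// lte_fin mulr_gt0// exprn_gt0.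
  have iqy2 : (lebesgue_cV k).-integrable setT (EFin \o (fun w => q (y, w) ^+ 2)).
    apply/integrableP; split.
      by apply/measurable_EFinP; exact: measurable_funX.
    under eq_integral do rewrite /= ger0_norm ?sqr_ge0//.
    by rewrite ltey.
  have IE : I = (\int[lebesgue_cV k]_w (q (y, w) ^+ 2))%:E.
    by rewrite /Rintegral fineK//; exact: integrable_fin_num iqy2.
  rewrite IE -EFinM lee_fin /G exprMn -[leRHS]mulrA ler_wpM2l ?sqr_ge0//.
  apply: (sqr_Rintegral_le mW) => //; first by rewrite /V lerDr.
  by move=> w; exact: q_outW.
exists G, rho; split => //.
- move=> y yrho; rewrite /G /Rintegral integral0_eq ?mulr0// => w _.
  by rewrite q_out.
- apply/integrableP; split.
    by apply/measurable_EFinP; exact: measurable_funX.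
  under eq_integral do rewrite /= ger0_norm ?sqr_ge0//.
  pose q2 : 'cV[R]_m * 'cV[R]_k -> \bar R := EFin \o (fun z => q z ^+ 2).
  have mq2 : measurable_fun setT q2 by exact: measurable_int iq2.
  have q20 z : (0 <= q2 z)%E by rewrite lee_fin sqr_ge0.
  apply: (@le_lt_trans _ _ (\int[lebesgue_cV m]_y ((c ^+ 2 * V)%:E *
      fubini_F (lebesgue_cV k) q2 y))%E).
    apply: ge0_le_integral => //.
    + by move=> y _; rewrite lee_fin sqr_ge0.
    + by apply/measurable_EFinP; exact: measurable_funX.
    + apply: measurable_funeM; exact: measurable_fun_fubini_tonelli_F.
  rewrite ge0_integralZl//; last 3 first.
    + exact: measurable_fun_fubini_tonelli_F.
    + by move=> y _; apply: integral_ge0 => w _; exact: q20.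
    + by rewrite lee_fin mulr_ge0 ?sqr_ge0// ltW.
  rewrite -fubini_tonelli1//.
  have := integrable_fin_num measurableT iq2.
  move=> fin; rewrite -(fineK fin) -EFinM; exact: ltry.
move=> b mb b1.
have ipb : (lebesgue_cV n).-integrable setT (EFin \o (fun u => p u * b (T *m u))).
  apply: le_integrable ip => //.
    apply/measurable_EFinP; apply: measurable_funM => //.
    exact: (measurableT_comp mb (measurable_mulmx_cV T)).
  by move=> u _; rewrite /= lee_fin normrM ler_piMr.
have [iqb ->] := Rintegral_linear_change c_gt0 PX muX ipb.
have E z : p (P *m glue z) * b (T *m (P *m glue z)) = q z * b z.1 by rewrite TP.
have {}iqb : prodmu.-integrable setT (EFin \o (fun z => q z * b z.1)).
  by move: iqb; apply: eq_integrable => // z _; rewrite /= E.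
under eq_Rintegral do rewrite E.
rewrite {1}/Rintegral -(integral12_prod_meas1 iqb).
have ibF := integrable_fubini_F iqb.
(* Inserting [fine] is legitimate because the fibre integrals are finite for almost every [y]. *)
transitivity (\int[lebesgue_cV m]_y
    (c * fine (fubini_F (lebesgue_cV k) (EFin \o (fun z => q z * b z.1)) y))).
  rewrite RintegralZl//; last first.
    apply: (le_integrable measurableT _ _ ibF).
      apply/measurable_EFinP; apply: measurableT_comp; first exact: fine_measurable.
      exact: measurable_int ibF.
    move=> y _; rewrite /=; set f := fubini_F _ _ _.
    by case: f => [x||] //=; rewrite normr0 leey.
  congr (c * _); rewrite /Rintegral; congr fine.
  apply: ae_eq_integral => //.
  - exact: measurable_int ibF.
  - apply/measurable_EFinP; apply: measurableT_comp; first exact: fine_measurable.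
    exact: measurable_int ibF.
  - have := integrable_ae measurableT ibF; apply: filterS => y yfin yT.
    by rewrite /= fineK//; exact: yfin.
rewrite /Rintegral; congr fine; apply: ae_eq_integral => //.
- apply/measurable_EFinP; apply: measurable_funM => //.
  apply: measurableT_comp; first exact: fine_measurable.
  exact: measurable_int ibF.
- by apply/measurable_EFinP; exact: measurable_funM.
(* On almost every fibre [q] is integrable, so the factor [b y] comes out of the integral. *)
have := ae_integrable1 iq; apply: filterS => y iqy _ /=.
rewrite /G -mulrA; congr (_ * _)%:E.
transitivity (\int[lebesgue_cV k]_w (q (y, w) * b y)) => //.
by rewrite RintegralZr.
Qed.

End marginal.

(** * Composition of Paley-Wiener functions with injective affine maps *)

Section paley_wiener_affine.
Context {R : realType}.

(** The rows of [tau] are a basis of a complement of the row space of [T]. The stacked matrix is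
    square only up to the equality [m + k = n], so its inverse is obtained as a pseudo-inverse. *)
Lemma row_free_completion (m n : nat) (T : 'M[R]_(m, n)) : row_free T ->
  exists (k : nat) (tau : 'M[R]_(k, n)) (P : 'M[R]_(n, m + k)),
    col_mx T tau *m P = 1%:M /\ P *m col_mx T tau = 1%:M.
Proof.
move=> Tfree; pose tau := row_base (T^C)%MS.
exists (\rank (T^C)%MS), tau; pose X := col_mx T tau; exists (pinvmx X).
have rkX : \rank X = n.
  rewrite -(addsmxE T tau) (adds_eqmx (eqmx_refl T) (eq_row_base _)).
  by apply/eqP; exact: addsmx_compl_full.
have rkT : \rank T = m by exact/eqP.
have mk : (m + \rank (T^C)%MS)%N = n.
  by rewrite mxrank_compl rkT subnKC// -rkT rank_leq_col.
split; last by apply: mulVpmx; rewrite /row_full -/X rkX.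
by apply: mulmxVp; rewrite /row_free -/X rkX mk.
Qed.

Lemma dotv_mulmx m n (A : 'M[R]_(n, m)) (u : 'cV[R]_n) (t : 'cV[R]_m) :
  dotv u (A *m t) = dotv (A^T *m u) t.
Proof.
rewrite /dotv; under eq_bigr do rewrite mxE mulr_sumr.
rewrite exchange_big; apply: eq_bigr => j _; rewrite mxE mulr_suml.
by apply: eq_bigr => i _; rewrite mxE; ring.
Qed.

Lemma bounded_mul_integrable d (T : measurableType d) (mu : {measure set T -> \bar R})
    (f b : T -> R) : mu.-integrable setT (EFin \o f) -> measurable_fun setT b ->
  (forall x, `|b x| <= 1) -> mu.-integrable setT (EFin \o (fun x => f x * b x)).
Proof.
move=> fi mb b1; apply: (le_integrable measurableT _ _ fi).
  apply/measurable_EFinP; apply: measurable_funM => //.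
  by apply/measurable_EFinP; exact: measurable_int fi.
by move=> x _; rewrite /= lee_fin normrM ler_piMr.
Qed.

Lemma eballS d (c : 'cV[R]_d) (r s : R) : 0 < r -> r <= s -> eball c r `<=` eball c s.
Proof.
move=> r0 rs u; rewrite /eball/= => /lt_le_trans; apply.
by rewrite lerXn2r// nnegrE ?(ltW r0)// (le_trans (ltW r0)).
Qed.

(** As [(u, A t + b) = (A^T u, t) + (u, b)], the new density is that of the push-forward of [h] by
    [A^T]. Real and imaginary parts are pushed forward separately and tested against the cosine and
    the sine. *)
Lemma PW_affine (m n : nat) (A : 'M[R]_(n, m)) (b : 'cV[R]_n) (f : 'cV[R]_n -> R[i]) :
  row_free A^T -> PW f -> PW (fun t => f (A *m t + b)).
Proof.
move=> Afree [g [c0 [r [gL2 r0 fE]]]].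
have [k [tau [P [XP PX]]]] := row_free_completion Afree.
have [c c_gt0 muX] := lebesgue_cV_linear XP PX.
have dens := pushforward_density c_gt0 XP PX muX (c0 := c0) r0.
pose B := eball c0 r; have mB : measurable B by exact: measurable_eball.
have Bfin : (lebesgue_cV n B < +oo)%E by exact: eball_finite.
pose h u := g u * expi (dotv u b).
have mh : cmeasurable h.
  apply: cmeasurableM; first exact: L2_cmeasurable.
  by apply: cmeasurable_expi; exact: measurable_linear_cV.
have nch u : nc (h u) = nc (g u) by rewrite /h ncM nc_expi mulr1.
have i2 : (lebesgue_cV n).-integrable setT (EFin \o (fun u => nc (g u) ^+ 2)).
  case: gL2 => gR gI gfin; apply/integrableP; split.
    by apply/measurable_EFinP; apply: measurable_funX; exact: cmeasurable_nc.
  by under eq_integral do rewrite /= ger0_norm ?sqr_ge0//.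
have dens_part (part : R[i] -> R) : measurable_fun setT (fun u => part (h u)) ->
    (forall z, `|part z| <= nc z) ->
    let p u := part (h u) * \1_B u in
    [/\ measurable_fun setT p, forall u, ~ B u -> p u = 0 &
      (lebesgue_cV n).-integrable setT (EFin \o (fun u => p u ^+ 2))].
  move=> mpart part_le p.
  have mp : measurable_fun setT p.
    by apply: measurable_funM => //; exact: measurable_indic.
  split => //.
    by move=> u nBu; rewrite /p indicE memNset// mulr0.
  apply: (le_integrable measurableT _ _ i2).
    by apply/measurable_EFinP; exact: measurable_funX.
  move=> u _; rewrite /= lee_fin !ger0_norm ?sqr_ge0//.
  rewrite -(real_normK (num_real (p u))) lerXn2r ?nnegrE ?nc_ge0//.
  rewrite /p normrM -nch; apply: (@le_trans _ _ `|part (h u)|) => //.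
  by rewrite ler_piMr// indicE; case: (u \in B); rewrite ?normr1 ?normr0.
have [mp1 p10 ip1] := dens_part (@complex.Re R) mh.1 (@normr_Re_le R).
have [mp2 p20 ip2] := dens_part (@complex.Im R) mh.2 (@normr_Im_le R).
set p1 := fun u => complex.Re (h u) * \1_B u in mp1 p10 ip1.
set p2 := fun u => complex.Im (h u) * \1_B u in mp2 p20 ip2.
have [G1 [rho1 [rho10 mG1 G10 iG1 G1E]]] := dens p1 mp1 p10 ip1.
have [G2 [rho2 [rho20 mG2 G20 iG2 G2E]]] := dens p2 mp2 p20 ip2.
have iP1 := L2_supported_integrable mB Bfin mp1 p10 ip1.
have iP2 := L2_supported_integrable mB Bfin mp2 p20 ip2.
have iG1' := L2_supported_integrable (measurable_eball 0 rho1) (eball_finite 0 rho10) mG1 G10 iG1.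
have iG2' := L2_supported_integrable (measurable_eball 0 rho2) (eball_finite 0 rho20) mG2 G20 iG2.
(* One ball outside which both densities vanish. *)
pose rho := rho1 + rho2; have rho0 : 0 < rho by rewrite addr_gt0.
have {}G10 y : ~ eball 0 rho y -> G1 y = 0.
  by move=> ny; apply: G10 => y1; apply: ny; apply: eballS y1; rewrite // lerDl ltW.
have {}G20 y : ~ eball 0 rho y -> G2 y = 0.
  by move=> ny; apply: G20 => y1; apply: ny; apply: eballS y1; rewrite // lerDr ltW.
exists (fun y => G1 y +i* G2 y), 0, rho; split => //.
  split => //.
  pose s1 : 'cV[R]_m -> \bar R := EFin \o (fun y => G1 y ^+ 2).
  pose s2 : 'cV[R]_m -> \bar R := EFin \o (fun y => G2 y ^+ 2).
  rewrite (_ : (fun u => _) = (s1 \+ s2)%E).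
    by have /(integrable_lty measurableT) := integrableD measurableT iG1 iG2.
  by apply/funext => y; rewrite sqr_nc.
move=> t.
have mlin d (x : 'cV[R]_d) : measurable_fun [set: 'cV[R]_d] (fun u => dotv u x).
  exact: measurable_linear_cV.
pose cs (y : 'cV[R]_m) := cos (dotv y t); pose sn (y : 'cV[R]_m) := sin (dotv y t).
have mcs : measurable_fun setT cs.
  exact: (measurableT_comp (continuous_measurable_fun (@continuous_cos R)) (mlin _ t)).
have msn : measurable_fun setT sn.
  exact: (measurableT_comp (continuous_measurable_fun (@continuous_sin R)) (mlin _ t)).
have cs1 y : `|cs y| <= 1 by exact: cos_max.
have sn1 y : `|sn y| <= 1 by exact: sin_max.
have mT : measurable_fun [set: 'cV[R]_n] (fun u => A^T *m u) by exact: measurable_mulmx_cV.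
have bT (q : 'cV[R]_n -> R) (s : 'cV[R]_m -> R) : measurable_fun setT s ->
    (forall y, `|s y| <= 1) -> (lebesgue_cV n).-integrable setT (EFin \o q) ->
    (lebesgue_cV n).-integrable setT (EFin \o (fun u => q u * s (A^T *m u))).
  by move=> ms s1 iq; apply: bounded_mul_integrable => //; exact: (measurableT_comp ms mT).
have expand u : g u * expi (dotv u (A *m t + b)) =
    h u * (cs (A^T *m u) +i* sn (A^T *m u)).
  rewrite /h addrC -mulrA dotvDr dotv_mulmx expiD//.
have RE : complex.Re (f (A *m t + b)) = \int[lebesgue_cV m]_y (G1 y * cs y - G2 y * sn y).
  rewrite fE /= Rintegral_mkcond.
  rewrite (_ : (fun u => _) \_ _ =
      (fun u => p1 u * cs (A^T *m u) - p2 u * sn (A^T *m u))); last first.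
    apply/funext => u; rewrite patchE expand /p1 /p2 indicE -/B.
    by case: (u \in B); rewrite ?mulr1 ?mulr0 ?mul0r ?subr0//; case: (h u).
  by rewrite RintegralB ?G1E ?G2E ?RintegralB//; (exact: bT || exact: bounded_mul_integrable).
have IE : complex.Im (f (A *m t + b)) = \int[lebesgue_cV m]_y (G1 y * sn y + G2 y * cs y).
  rewrite fE /= Rintegral_mkcond.
  rewrite (_ : (fun u => _) \_ _ =
      (fun u => p1 u * sn (A^T *m u) + p2 u * cs (A^T *m u))); last first.
    apply/funext => u; rewrite patchE expand /p1 /p2 indicE -/B.
    by case: (u \in B); rewrite ?mulr1 ?mulr0 ?mul0r ?addr0//; case: (h u).
  by rewrite RintegralD ?G1E ?G2E ?RintegralD//; (exact: bT || exact: bounded_mul_integrable).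
rewrite (_ : f (A *m t + b) = complex.Re (f (A *m t + b)) +i* complex.Im (f (A *m t + b))).
  rewrite RE IE /cintegral; congr (_ +i* _); rewrite [RHS]Rintegral_mkcond;
    apply: eq_Rintegral => y _; rewrite patchE; case: ifPn => // /negP yn.
    by rewrite G10 ?G20 ?mul0r ?subr0// => yB; apply: yn; exact: mem_set.
  by rewrite G10 ?G20 ?mul0r ?addr0// => yB; apply: yn; exact: mem_set.
by case: (f _).
Qed.

End paley_wiener_affine.

(** * Injectivity *)

Section injectivity.
Context {R : realType}.

Lemma lebesgue_cV1_point : lebesgue_cV 1 [set (0 : 'cV[R]_1)] = 0%E.
Proof.
rewrite (_ : [set 0] = cbox (fun=> [set (0 : R)])).
  rewrite [LHS](lebesgue_cV_box (A := fun=> [set (0 : R)]))// big_ord1.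
  exact: lebesgue_measure_set1.
apply/seteqP; split => [x -> i /=|x x0]; first by rewrite mxE.
by apply/colP => i; rewrite x0 mxE.
Qed.

Lemma half_double (a : R[i]) : (2^-1)%:C * (a + a) = a.
Proof.
by case: a => p q; apply/eqP; rewrite eq_complex /=; apply/andP; split;
  apply/eqP; field.
Qed.

(** The midpoint of two distinct points of the unit circle lies strictly inside: the squared modulus
    is [1 - sin (x / 2) ^+ 2]. *)
Lemma nc_half_sum_lt1 (x : R) : x != 0 -> `|x| <= 1 ->
  nc ((2^-1)%:C * (1 + expi x)) < 1.
Proof.
move=> x0 x1; rewrite -(ltr_pXn2r (n := 2))// ?nnegrE ?nc_ge0// expr1n.
rewrite ncM exprMn !sqr_nc /= expr0n/= addr0 add0r.
have c2 := cos2Dsin2 x.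
have : sin (x / 2) ^+ 2 > 0.
  rewrite exprn_even_gt0//= -normr_gt0.
  have := @sin_ge_half R (x / 2); rewrite normrM normfV (ger0_norm (x := 2))//.
  have xpos : 0 < `|x| by rewrite normr_gt0.
  by move=> hs; lra.
by have := cosE_sin_half x; nra.
Qed.

(* A constant [a = \int_B g(u) expi(u t)] is also [\int_B g(u) p(expi(h u))] for every
   polynomial [p] with [p(1) = 1]; take [p = ((1 + z) / 2)^j], which tends to [0]
   off [z = 1]. *)
Lemma PW_constant_eq0 (a : R[i]) : PW (fun _ : 'cV[R]_1 => a) -> a = 0.
Proof.
move=> [g [c [r [gL2 r0 aE]]]]; set B := eball c r in aE.
have mB : measurable B by exact: measurable_eball.
have Bfin : (lebesgue_cV 1 B < +oo)%E by exact: eball_finite.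
have [K cK] := eball_bounded c r0.
(* So small that [|x u| <= 1] on [B], which leaves 0 as the only point of [B] where [z] can have
   modulus 1. *)
pose h := (`|K| + 1)^-1.
have h0 : 0 < h by rewrite invr_gt0 ltr_wpDl.
pose x (u : 'cV[R]_1) := dotv u (const_mx h).
have xE u : x u = u ord0 ord0 * h by rewrite /x /dotv big_ord1 mxE.
have x1 u : B u -> `|x u| <= 1.
  move=> Bu; rewrite xE normrM (gtr0_norm h0) ler_pdivrMr ?ltr_wpDl// mul1r.
  by rewrite (le_trans (cK u Bu _))// (le_trans (ler_norm _))// lerDl.
have x0 u : u != 0 -> x u != 0.
  apply: contra; rewrite xE mulf_eq0 (gt_eqF h0) orbF => /eqP u0.
  by apply/eqP/colP => i; rewrite mxE ord1.
pose z u := (2^-1)%:C * (1 + expi (x u)).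
have mz : cmeasurable z.
  apply: cmeasurableM; first exact: cmeasurable_cst.
  apply: cmeasurableD; first exact: cmeasurable_cst.
  by apply: cmeasurable_expi; exact: measurable_linear_cV.
have z1 u : B u -> nc (z u) <= 1.
  move=> Bu; have [->|u0] := eqVneq u 0.
    by rewrite /z xE mxE mul0r expi0 half_double nc1.
  by apply/ltW/nc_half_sum_lt1; [exact: x0|exact: x1].
have zlt u : B u -> u != 0 -> nc (z u) < 1.
  by move=> Bu u0; apply: nc_half_sum_lt1; [exact: x0|exact: x1].
have zE u : z u = (2^-1)%:C * (1 + expi (x u)) by [].
clearbody z.
pose w (u : 'cV[R]_1) := 1 + nc (g u) ^+ 2.
have w0 u : 0 <= w u by rewrite addr_ge0// sqr_ge0.
have iw : (lebesgue_cV 1).-integrable B (EFin \o w) by exact: L2_weight_integrable.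
pose F j t u := g u * expi (dotv u t) * z u ^+ j.
have mF j t : cmeasurable (F j t).
  apply: cmeasurableM; last exact: cmeasurableX.
  apply: cmeasurableM; first exact: L2_cmeasurable.
  by apply: cmeasurable_expi; exact: measurable_linear_cV.
have Fw j t u : B u -> nc (F j t u) <= w u * nc (z u) ^+ j.
  move=> Bu; rewrite /F ncM (ncM (g u)) nc_expi mulr1 ncX ler_wpM2r ?exprn_ge0 ?nc_ge0//.
  exact: nc_le_weight.
have mwz j : measurable_fun setT (fun u => w u * nc (z u) ^+ j).
  apply: measurable_funM.
    apply: measurable_funD => //; apply: measurable_funX.
    by apply: cmeasurable_nc; exact: L2_cmeasurable.
  by apply: measurable_funX; exact: cmeasurable_nc.
have wz_le j u : B u -> w u * nc (z u) ^+ j <= w u.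
  by move=> Bu; rewrite ler_piMr// exprn_ile1 ?nc_ge0// z1.
have iwz j : (lebesgue_cV 1).-integrable B (EFin \o (fun u => w u * nc (z u) ^+ j)).
  apply: (le_integrable mB _ _ iw).
    by apply/measurable_EFinP; exact: measurable_funS (mwz j).
  move=> u Bu; rewrite /= lee_fin !ger0_norm ?mulr_ge0 ?exprn_ge0 ?nc_ge0//.
  exact: wz_le.
have iF j t : cintegrable B (F j t).
  exact: cintegrable_dom (mF j t) (iwz j) (Fw j t).
(* Averaging the representations of [a] at [t] and at [t + const_mx h] multiplies the integrand by
   [z]. *)
have aF j t : a = cintegral B (F j t).
  elim: j t => [|j IH] t.
    by rewrite (aE t); apply: eq_cintegral => u _; rewrite /F expr0 mulr1.
  transitivity ((2^-1)%:C * (cintegral B (F j t) + cintegral B (F j (t + const_mx h)))).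
    by rewrite -!IH half_double.
  rewrite -cintegralD// -cintegralZ//; last first.
    pose W u := w u * nc (z u) ^+ j.
    apply: (cintegrable_dom mB _ (integrableD mB (iwz j) (iwz j))) => /=.
      exact: cmeasurableD.
    by move=> u Bu; apply: le_trans (ncD _ _) _; rewrite lerD// Fw.
  apply: eq_cintegral => u _; rewrite /F dotvDr expiD exprS -/(x u).
  by set zj := z u ^+ j; rewrite zE; ring.
(* Dominated convergence with majorant [w]; the powers of [z] tend to 0 off the null set reduced to
   the origin. *)
have cv : (fun j => (\int[lebesgue_cV 1]_(u in B) (w u * nc (z u) ^+ j)%R%:E)%E) @ \oo
    --> 0%:E.
  have [|||||_ _] := @dominated_convergence _ _ _ (lebesgue_cV 1) B mB
    (fun j u => (w u * nc (z u) ^+ j)%:E) (cst 0%E) (EFin \o w).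
  - by move=> j; apply/measurable_EFinP; exact: measurable_funS (mwz j).
  - exact: measurable_cst.
  - exists [set 0]; split; [|exact: lebesgue_cV1_point|].
      rewrite (_ : [set 0] = cbox (fun=> [set (0 : R)])); last first.
        apply/seteqP; split => [y -> i /=|y y0]; first by rewrite mxE.
        by apply/colP => i; rewrite y0 mxE.
      by apply: measurable_cbox.
    move=> u /= nu; apply: contrapT => u0; apply: nu => Bu.
    apply: cvg_EFin; first exact: nearW.
    have cz : w u * nc (z u) ^+ j @[j --> \oo] --> w u * 0.
      by apply: cvgMr; apply: cvg_expr; rewrite ger0_norm ?nc_ge0// zlt//; exact/eqP.
    by rewrite mulr0 in cz; exact: cz.
  - by [].
  - apply: aeW => u j Bu; rewrite /= lee_fin ger0_norm ?mulr_ge0 ?exprn_ge0 ?nc_ge0//.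
    exact: wz_le.
  by rewrite integral0.
have cv2 : 2 * \int[lebesgue_cV 1]_(u in B) (w u * nc (z u) ^+ j) @[j --> \oo] --> 2 * (0 : R).
  by apply: cvgMr; exact: fine_cvg cv.
rewrite mulr0 in cv2.
apply/eqP; rewrite -nc_eq0 eq_le nc_ge0 andbT; apply: (cvgr_to_ge cv2).
apply: nearW => j; rewrite (aF j 0); exact: nc_cintegral_le (mF j 0) (iwz j) (Fw j 0).
Qed.

(** Along the line spanned by a nonzero kernel vector the composite is the constant [f b], where [f]
    is chosen nonzero at [b]. [PW_affine] for that line places it among the Paley-Wiener functions
    of one variable. *)
Lemma PW_superposition_injective (m n : nat) (A : 'M[R]_(n, m)) (b : 'cV[R]_n) :
  (forall f : 'cV[R]_n -> R[i], PW f -> PW (fun t => f (A *m t + b))) ->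
  forall v : 'cV[R]_m, A *m v = 0 -> v = 0.
Proof.
move=> APW v Av; apply/eqP/negPn/negP => v0.
have [f [fPW f0]] := PW_nonvanishing n (\sum_i `|b i ord0|).
have vfree : row_free v^T.
  by rewrite /row_free rank_rV trmx_eq0 v0.
have := PW_affine 0 vfree (APW f fPW).
rewrite (_ : (fun t => _) = (fun=> f b)).
  move=> /PW_constant_eq0 /eqP; apply/negP; apply: f0 => i.
  by rewrite (bigD1 i)//= lerDl sumr_ge0.
by apply/funext => t; rewrite addr0 mulmxA Av mul0mx add0r.
Qed.

End injectivity.

Local Close Scope complex_scope.
Unset Implicit Arguments.

Theorem mainTheorem1 (R : realType) (m n : nat) (hm : (0 < m)%N)
    (hn : (0 < n)%N) (phi : 'cV[R]_m -> 'cV[R]_n) (cphi : continuous phi) :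
  (forall f : 'cV[R]_n -> R[i], PW f -> PW (f \o phi)) <->
  (injective phi /\ affine_map phi).
Proof.
split=> [phiPW|[phi_inj [A [b phiE]]] f fPW].
  have [A [b phiE]] := PW_superposition_affine cphi phiPW.
  split; last by exists A, b.
  move=> s t st; apply/eqP; rewrite -subr_eq0; apply/eqP.
  apply: (@PW_superposition_injective R m n A b) => [f fPW|].
    by have := phiPW f fPW; congr PW; apply/funext => x; rewrite /= phiE.
  apply/eqP; rewrite mulmxBr subr_eq0; apply/eqP.
  by apply: (addIr b); rewrite -!phiE.
(* The rows of [A^T] are the columns of [A], independent because [A] has trivial kernel. *)
have Afree : row_free A^T.
  apply: inj_row_free => v vA.
  have : A *m v^T = 0 by rewrite -[A]trmxK -trmx_mul vA trmx0.
  move=> Av; apply: trmx_inj; rewrite trmx0; apply: phi_inj.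
  by rewrite !phiE Av mulmx0.
rewrite (_ : f \o phi = fun t => f (A *m t + b)); first exact: PW_affine.
by apply/funext => t; rewrite /= phiE.
Qed.
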